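(* Let $0<\alpha<\beta<1$, let $\theta\in\mathbb{R}$ with $\theta\ne\pi n$ for all $n\in\mathbb{Z}$, and let $w(e^{it})=|e^{it}-1|^\beta|e^{it}-e^{i\theta}|^\alpha$. Suppose $\lambda=(\lambda_j)_{j\in\mathbb{Z}}\in\mathrm{Mult}(L^2(w))$, so that $\lambda=\mathcal{F}k$, where $k$ is a pseudo-measure on $\mathbb{T}$ such that $\|k\star f\|_{L^2(w)}\le C\|f\|_{L^2(w)}$ for all $f\in L^2(w)$. If $\inf_{j\in\mathbb{Z}}|\lambda_j|>0$, then $1/\lambda=(1/\lambda_j)_{j\in\mathbb{Z}}\in\mathrm{Mult}(L^2(w))$.
   Context: $\mathbb{T}$ is the unit circle with normalized Lebesgue measure $m$, $L^2(w)=L^2(\mathbb{T},w\,dm)$. $\mathrm{Mult}(L^2(w))$ is the set of complex sequences $\lambda=(\lambda_n)_{n\in\mathbb{Z}}$ such that $e^{inx}\mapsto\lambda_ne^{inx}$ $(n\in\mathbb{Z})$ extends to a bounded linear operator on $L^2(w)$ (then automatically $\lambda\in l^\infty(\mathbb{Z})$). A pseudo-measure $k$ is a distribution on $\mathbb{T}$ with bounded Fourier coefficients $\mathcal{F}k=(\hat k(n))_{n\in\mathbb{Z}}$, and $k\star f=\sum_n\hat k(n)\hat f(n)e^{int}$ for trigonometric polynomials $f$, extended by continuity. *)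

(* Defs.v *)
From HB Require Import structures.
From mathcomp Require Import all_boot all_order all_algebra.
From mathcomp Require Import complex.
From mathcomp Require Import all_classical all_reals all_analysis.

Set Implicit Arguments.
Unset Strict Implicit.
Unset Printing Implicit Defensive.

Import Order.TTheory GRing.Theory Num.Theory.
Import numFieldNormedType.Exports.

Local Open Scope classical_set_scope.
Local Open Scope complex_scope.
Local Open Scope ring_scope.

(* A function on the unit circle is represented by its pull-back
   f : R -> R[i] under t |-> e^{it}; only the values on [0, 2 pi[ matter. *)
Definition circle_dom (R : realType) : set R := `[0, 2 * pi[.

Definition expi (R : realType) (t : R) : R[i] := cos t +i* sin t.

Definition cmod (R : realType) (z : R[i]) : R := ComplexField.Normc.normc z.

Definition char_circle (R : realType) (n : int) (t : R) : R[i] :=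
  expi (n%:~R * t).

Definition normL2 (R : realType) (w : R[i] -> R) (f : R -> R[i]) : \bar R :=
  (((2 * pi)^-1%:E *
    \int[@lebesgue_measure R]_(t in @circle_dom R)
      (cmod (f t) ^+ 2 * w (expi t))%:E) `^ 2^-1)%E.

Definition cmeasurable (R : realType) (f : R -> R[i]) : Prop :=
  measurable_fun (@circle_dom R) (fun t => complex.Re (f t)) /\
  measurable_fun (@circle_dom R) (fun t => complex.Im (f t)).

Definition inL2 (R : realType) (w : R[i] -> R) (f : R -> R[i]) : Prop :=
  cmeasurable f /\ (normL2 w f < +oo)%E.

(* equality w dm-almost everywhere, i.e., equality in L^2(w) *)
Definition eqL2 (R : realType) (w : R[i] -> R) (f g : R -> R[i]) : Prop :=
  {ae @lebesgue_measure R, forall t, @circle_dom R t ->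
    w (expi t) != 0 -> f t = g t}.

(* T acts on representatives. Linearity and the norm bound together force T to
   respect eqL2, so T is the same as a bounded linear operator on the
   quotient space L^2(w). *)
Record bounded_operator (R : realType) (w : R[i] -> R)
    (T : (R -> R[i]) -> (R -> R[i])) : Prop := BoundedOperator {
  bounded_operator_stable : forall f, inL2 w f -> inL2 w (T f) ;
  bounded_operator_linear : forall (a : R[i]) f g, inL2 w f -> inL2 w g ->
    eqL2 w (T (fun t => a * f t + g t)) (fun t => a * T f t + T g t) ;
  bounded_operator_bound : exists C : R, forall f, inL2 w f ->
    (normL2 w (T f) <= C%:E * normL2 w f)%E }.

Definition Mult (R : realType) (w : R[i] -> R) (lambda : int -> R[i]) : Prop :=
  exists2 T, bounded_operator w T &
    forall n : int,
      eqL2 w (T (char_circle n)) (fun t => lambda n * char_circle n t).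

Definition two_zero_weight (R : realType) (alpha beta theta : R) (z : R[i]) : R
  := cmod (z - 1) `^ beta * cmod (z - expi theta) `^ alpha.

(* Main.v *)
Require Import Defs.
From HB Require Import structures.
From mathcomp Require Import all_boot all_order all_algebra.
From mathcomp Require Import complex ring lra.
From mathcomp Require Import all_classical all_reals all_analysis.
From mathcomp Require Import measurable_realfun.

(* Write [zeta = e^{i theta}], [w1 = |z - 1|^beta], [w2 = |z - zeta|^alpha], so
   that [w = w1 w2]. Multiplying the kernel of a multiplier [lambda] of L^2(w) by
   a polynomial in [z] that vanishes at a point kills the interaction between
   two arcs of the circle at that distance. Lagrange interpolation at the points
   1, zeta, 1/zeta (distinct since sin theta <> 0) splits [lambda] as
   [l0 + r1 + r2], where [l0] multiplies L^2(w1) and L^2(w2), [r1] maps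
   L^2(w1) to L^2(w2) and L^2(w2) to L^2, and [r2] maps L^2(w1) to L^2. Hence
   [r1^2] and [r2] map L^2(w1) to L^2, a property that only depends on the
   moduli of the symbols.

   By Parseval and [|z - a|^s ~ sum_k 2^(-ks) |z^(2^k) - a^(2^k)|^2], the
   multipliers of L^2(|z - a|^s) are stable under Lipschitz functions. With [G] a
   bounded Lipschitz extension of [z |-> 1 / z] and [Lam = G l0],
     [1 / lambda = Lam (2 - lambda Lam) + (1 - lambda Lam)^2 / lambda]
   and the last term is dominated by [|r1|^2 + |r2|].

   A symbol that is bounded on trigonometric polynomials is extended to L^2(w)
   through the orthogonal projection on their closure, so their density is not
   needed. *)

Import Order.TTheory GRing.Theory Num.Theory.
Import numFieldNormedType.Exports.

Set Implicit Arguments.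
Unset Strict Implicit.
Unset Printing Implicit Defensive.

Local Open Scope classical_set_scope.
Local Open Scope complex_scope.
Local Open Scope ring_scope.

(** * The modulus and fractional powers of [|z - a|] *)

(** A point of the kernel is a ratio output/input. A zero of [w] facing itself gives the ratio 1,
    input 1 with output zeta gives zeta, and input zeta with output 1 gives 1/zeta. So [l0] keeps
    each zero facing itself, while [r1] and [r2] keep one mixed interaction each. The obstacle is
    that the description of a weighted norm by coefficient differences concerns a single zero. It
    makes Lipschitz functions of [l0] available, but not of [lambda]. The mixed parts must be
    treated by domination of moduli, and this requires an unweighted target. Now [r1] carries
    L^2(w1) only into L^2(w2), and a second factor [r1] is needed to reach L^2. This is why the
    residual 1 - lambda Lam has to appear squared: Lam (2 - lambda Lam) is one Newton step towards 1
    / lambda, and a Newton step squares the residual. The residual is O(|r1| + |r2|) at every index: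
    where [l0] is too small to be inverted, the lower bound on [lambda] forces |r1| + |r2| to be
    large. The two zeros are not symmetric. A bound from L^2(w1) to L^2 can be rotated to the point
    zeta, and alpha <= beta then turns it into a bound from L^2(w2). *)

Section Modulus.
Variable R : realType.
Implicit Types (x y z : R[i]) (r s t u : R).

Lemma cmod_ge0 z : 0 <= cmod z.
Proof. by case: z => a b; exact: sqrtr_ge0. Qed.

Lemma cmodE2 z : cmod z ^+ 2 = complex.Re z ^+ 2 + complex.Im z ^+ 2.
Proof. by case: z => a b; rewrite sqr_sqrtr// addr_ge0 ?sqr_ge0. Qed.

Lemma cmod0 : cmod (0 : R[i]) = 0. Proof. exact: ComplexField.Normc.normc0. Qed.

Lemma cmod1 : cmod (1 : R[i]) = 1. Proof. exact: ComplexField.Normc.normc1. Qed.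

Lemma cmod_eq0 z : (cmod z == 0) = (z == 0).
Proof.
apply/eqP/eqP => [|->]; last exact: cmod0.
exact: ComplexField.Normc.eq0_normc.
Qed.

Lemma cmod_gt0 z : (0 < cmod z) = (z != 0).
Proof. by rewrite lt_def cmod_ge0 andbT cmod_eq0. Qed.

Lemma cmodM x y : cmod (x * y) = cmod x * cmod y.
Proof. exact: ComplexField.Normc.normcM. Qed.

Lemma cmodV x : cmod x^-1 = (cmod x)^-1.
Proof. exact: ComplexField.Normc.normcV. Qed.

Lemma cmodX x n : cmod (x ^+ n) = cmod x ^+ n.
Proof. by elim: n => [|n IH]; rewrite ?cmod1// !exprS cmodM IH. Qed.

Lemma cmodD x y : cmod (x + y) <= cmod x + cmod y.
Proof. exact: le_normcD. Qed.

Lemma cmodN x : cmod (- x) = cmod x. Proof. exact: normcN. Qed.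

Lemma cmodB x y : cmod (x - y) <= cmod x + cmod y.
Proof. by rewrite -(cmodN y) cmodD. Qed.

Lemma cmod_distC x y : cmod (x - y) = cmod (y - x).
Proof. by rewrite -cmodN opprB. Qed.

Lemma cmod_dist_ge x y : `|cmod x - cmod y| <= cmod (x - y).
Proof.
have := cmodD (x - y) y; have := cmodD (y - x) x.
rewrite !subrK (cmod_distC y x) => h1 h2.
by rewrite ler_norml; apply/andP; split; lra.
Qed.

Lemma cmod_parallelogram x y :
  cmod (x + y) ^+ 2 + cmod (x - y) ^+ 2 = 2 * (cmod x ^+ 2 + cmod y ^+ 2).
Proof. by rewrite !cmodE2 !raddfD !raddfN /=; ring. Qed.

Lemma cmod_sqD x y : cmod (x + y) ^+ 2 <= 2 * (cmod x ^+ 2 + cmod y ^+ 2).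
Proof. by rewrite -cmod_parallelogram lerDl sqr_ge0. Qed.

Lemma cmod_conjc z : cmod z^* = cmod z.
Proof. by case: z => a b /=; rewrite sqrrN. Qed.

Lemma mul_conjc z : z * z^* = (cmod z ^+ 2)%:C.
Proof. by rewrite cmodE2; case: z => a b; simpc; congr (_ +i* _); ring. Qed.

Lemma cmod_real r : cmod (r%:C) = `|r|.
Proof. by rewrite /cmod /= expr0n /= addr0 sqrtr_sqr. Qed.

Lemma cmod_Re_le z : `|complex.Re z| <= cmod z.
Proof. by rewrite -ler_sqr ?nnegrE ?cmod_ge0// real_normK ?num_real// cmodE2 lerDl sqr_ge0. Qed.

Lemma expi0 : expi (0 : R) = 1. Proof. by rewrite /expi cos0 sin0. Qed.

Lemma expiD s t : expi (s + t) = expi s * expi t.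
Proof. by rewrite /expi cosD sinD; simpc; congr (_ +i* _); ring. Qed.

Lemma expiN t : expi (- t) = (expi t)^*.
Proof. by rewrite /expi cosN sinN. Qed.

Lemma cmod_expi t : cmod (expi t) = 1.
Proof. by rewrite /cmod /= cos2Dsin2 sqrtr1. Qed.

Lemma char_circleD (m n : int) t :
  char_circle (m + n) t = char_circle m t * char_circle n t.
Proof. by rewrite /char_circle intrD mulrDl expiD. Qed.

Lemma char_circle0 t : char_circle 0 t = 1.
Proof. by rewrite /char_circle mul0r expi0. Qed.

Lemma char_circle1 t : char_circle 1 t = expi t.
Proof. by rewrite /char_circle mul1r. Qed.

Lemma char_circleN (n : int) t : char_circle (- n) t = (char_circle n t)^*.
Proof. by rewrite /char_circle mulrNz mulNr expiN. Qed.

Lemma char_circleX (k : nat) t : char_circle k%:Z t = expi t ^+ k.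
Proof.
elim: k => [|k IH]; first by rewrite char_circle0.
by rewrite intS char_circleD char_circle1 IH exprS.
Qed.

Lemma cmod_char_circle (n : int) t : cmod (char_circle n t) = 1.
Proof. exact: cmod_expi. Qed.

End Modulus.

(** * Powers of |z - a| compared with dyadic sums *)

Section PowerWeights.
Variable R : realType.
Implicit Types (x y z a : R[i]) (r s t u q : R).

Lemma cmod_unitB_le2 x y : cmod x = 1 -> cmod y = 1 -> cmod (x - y) <= 2.
Proof. by move=> hx hy; have := cmodB x y; rewrite hx hy. Qed.

(** A factor z - a contributes |z - a|^2 to a squared norm, and the weight |z - a|^s controls this
    with constant 2^(2 - s) <= 4. Every exchange of a polynomial zero for a zero of the weight rests
    on this. *)
Lemma sqr_le_powR u s : 0 <= u <= 2 -> 0 < s <= 1 -> u ^+ 2 <= 4 * u `^ s.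
Proof.
move=> /andP[u0 u2] /andP[s0 s1].
have [->|un0] := eqVneq u 0; first by rewrite expr0n mulr_ge0 ?powR_ge0.
have up : 0 < u by rewrite lt_def un0.
have -> : u ^+ 2 = u `^ s * u `^ (2 - s).
  by rewrite -powRD ?un0 ?implybT// addrC subrK -powR_mulrn.
rewrite mulrC ler_wpM2r ?powR_ge0//.
apply: (@le_trans _ _ (2 `^ (2 - s))).
  by apply: ge0_ler_powR; rewrite ?nnegrE; lra.
apply: (@le_trans _ _ (2 `^ 2)); first by apply: ler_powR; lra.
by rewrite -[X in _ `^ X]/(2%:R) powR_mulrn//; lra.
Qed.

Lemma powR_le4 u s : 0 <= u <= 2 -> 0 < s <= 1 -> u `^ s <= 4.
Proof.
move=> /andP[u0 u2] /andP[s0 s1].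
apply: (@le_trans _ _ (2 `^ s)).
  by apply: ge0_ler_powR; rewrite ?nnegrE; lra.
apply: (@le_trans _ _ (2 `^ 1)); first by apply: ler_powR; lra.
by rewrite powRr1; lra.
Qed.

Lemma powR_le_exponent u r s : 0 <= u <= 2 -> 0 < r <= s -> s <= 1 ->
  u `^ s <= 4 * u `^ r.
Proof.
move=> /andP[u0 u2] /andP[r0 rs] s1.
have [->|un0] := eqVneq u 0.
  by rewrite powR0 ?mulr_ge0 ?powR_ge0// gt_eqF//; lra.
have -> : u `^ s = u `^ r * u `^ (s - r).
  by rewrite -powRD ?un0 ?implybT// addrC subrK.
rewrite mulrC ler_wpM2r ?powR_ge0//.
have [->|rns] := eqVneq r s; first by rewrite subrr powRr0; lra.
apply: powR_le4; first by rewrite u0.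
by rewrite subr_gt0 lt_def eq_sym rns rs /=; lra.
Qed.

(* [1 - x <= exp (- x)] and [exp (- y) <= 1 / (1 + y)] bound the tangent of the
   concave function [x |-> x ^ r] up to a factor [1/2]. *)
Lemma powR_1B_le r u : 0 < r <= 1 -> 0 <= u <= 1 ->
  (1 - u) `^ r <= 1 - r * u / 2.
Proof.
move=> /andP[r0 r1] /andP[u0 u1].
have h : (1 - u) `^ r <= expR (- (r * u)).
  have -> : expR (- (r * u)) = expR (- u) `^ r.
    by rewrite -expRM mulNr mulrC.
  by apply: ge0_ler_powR; rewrite ?nnegrE ?expR_ge0//; [lra|lra|exact: expR_ge1Dx].
apply: (le_trans h).
rewrite expRN.
have h1 := expR_ge1Dx (r * u).
have ru0 : 0 <= r * u by rewrite mulr_ge0// ltW.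
have ru1 : r * u <= 1 by rewrite mulr_ile1// ltW.
apply: (@le_trans _ _ (1 + r * u)^-1).
  by rewrite lef_pV2// posrE ?expR_gt0//; lra.
rewrite -div1r ler_pdivrMr; last by lra.
by nra.
Qed.

Lemma powR_1B_ge r u : 0 < r <= 1 -> 0 <= u <= 1 -> 1 - u <= (1 - u) `^ r.
Proof.
move=> /andP[r0 r1] /andP[u0 u1].
have [->|un1] := eqVneq u 1; first by rewrite subrr powR_ge0.
rewrite -{1}[1 - u]powRr1; last by lra.
apply: ger_powR => //; apply/andP; split; last by lra.
by rewrite subr_gt0 lt_def eq_sym un1.
Qed.

(** With d = |z - a|, the differences |z^(2^k) - a^(2^k)| grow like 2^k d until 2^k reaches 1/d and
    never exceed 2. The series is therefore of order d^2 (1/d)^(2 - s) = d^s. *)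
Definition dyadic_weight (s : R) a (K : nat) z : R :=
  \sum_(k < K.+1) (2 `^ (- s)) ^+ k * cmod (z ^+ (2 ^ k) - a ^+ (2 ^ k)) ^+ 2.

Lemma dyadic_weightS s a K z : dyadic_weight s a K.+1 z =
  cmod (z - a) ^+ 2 + 2 `^ (- s) * dyadic_weight s (a ^+ 2) K (z ^+ 2).
Proof.
rewrite /dyadic_weight big_ord_recl /= expr0 mul1r expn0 !expr1; congr (_ + _).
rewrite big_distrr /=; apply: eq_bigr => k _.
by rewrite /bump /= add1n exprS mulrA expnS !exprM.
Qed.

Lemma cmod_sqrB x y : cmod x = 1 -> cmod y = 1 ->
  cmod (x ^+ 2 - y ^+ 2) ^+ 2 = cmod (x - y) ^+ 2 * (4 - cmod (x - y) ^+ 2).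
Proof.
move=> hx hy; rewrite subr_sqr cmodM exprMn.
by have := cmod_parallelogram x y; rewrite hx hy => h; congr (_ * _); lra.
Qed.

(** Squaring doubles the angle: |x + y| / 2 = sqrt(1 - d^2 / 4) with d = |x - y|. This is the
    functional equation that drives both inductions on the dyadic sum. *)
Lemma powR_doubling s x y : cmod x = 1 -> cmod y = 1 ->
  2 `^ (- s) * cmod (x ^+ 2 - y ^+ 2) `^ s =
  cmod (x - y) `^ s * (1 - cmod (x - y) ^+ 2 / 4) `^ (s / 2).
Proof.
move=> hx hy; set d := cmod (x - y).
have d0 : 0 <= d by exact: cmod_ge0.
have d2 : d <= 2 by exact: cmod_unitB_le2.
have sq r : 0 <= r -> r `^ s = (r ^+ 2) `^ (s / 2).
  by move=> r0; rewrite -powR_mulrn// -powRrM mulrCA divff ?mulr1.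
have h4 : 0 <= 1 - d ^+ 2 / 4 by nra.
rewrite sq ?cmod_ge0// cmod_sqrB// -/d.
have -> : d ^+ 2 * (4 - d ^+ 2) = 2 ^+ 2 * (d ^+ 2 * (1 - d ^+ 2 / 4)) by field.
rewrite powRM ?sqr_ge0 ?mulr_ge0 ?sqr_ge0//.
rewrite powRM ?sqr_ge0// -!sq// mulrA -powRD ?pnatr_eq0 ?implybT//.
by rewrite addNr powRr0 mul1r.
Qed.

(** Iterates d^s <= d^2 + 2^(-s) |x^2 - y^2|^s. The defect d^s d^2 / 4 in the doubling identity is
    at most d^2 because d^s <= 4. The error term is what remains after K + 1 doublings. *)
Lemma pow_le_dyadic s a K z : 0 < s < 1 -> cmod a = 1 -> cmod z = 1 ->
  cmod (z - a) `^ s <= dyadic_weight s a K z + 4 * (2 `^ (- s)) ^+ K.+1.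
Proof.
move=> /andP[s0 s1].
have step x y : cmod x = 1 -> cmod y = 1 -> cmod (x - y) `^ s <=
    cmod (x - y) ^+ 2 + 2 `^ (- s) * cmod (x ^+ 2 - y ^+ 2) `^ s.
  move=> hx hy; rewrite powR_doubling//; set d := cmod (x - y).
  have d0 : 0 <= d by exact: cmod_ge0.
  have d2 : d <= 2 by exact: cmod_unitB_le2.
  have h : 1 - d ^+ 2 / 4 <= (1 - d ^+ 2 / 4) `^ (s / 2).
    by apply: powR_1B_ge; apply/andP; split; nra.
  have p0 := powR_ge0 d s.
  have p4 : d `^ s <= 4 by apply: powR_le4; apply/andP; split; lra.
  have := ler_wpM2l p0 h; rewrite mulrBr mulr1 => h'.
  have : 0 <= (4 - d `^ s) * (d ^+ 2 / 4).
    by rewrite mulr_ge0 ?subr_ge0// divr_ge0 ?sqr_ge0.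
  lra.
have q0 := powR_ge0 2 (- s).
elim: K z a => [|K IH] z a ha hz.
  rewrite /dyadic_weight big_ord_recl big_ord0 addr0 expr0 mul1r expn0 !expr1.
  apply: (le_trans (step _ _ hz ha)); rewrite lerD2l mulrC ler_wpM2r//.
  apply: powR_le4; last by apply/andP; split; lra.
  by rewrite cmod_ge0 cmod_unitB_le2 ?cmodX ?hz ?ha ?expr1n.
rewrite dyadic_weightS; apply: (le_trans (step _ _ hz ha)).
rewrite -addrA lerD2l [(2 `^ (- s)) ^+ K.+2]exprS mulrCA -mulrDr ler_wpM2l//.
by apply: IH; rewrite cmodX ?hz ?ha expr1n.
Qed.

(* The subtracted square makes the induction on [K] go through. *)
Lemma dyadic_le_pow s a K z : 0 < s < 1 -> cmod a = 1 -> cmod z = 1 ->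
  dyadic_weight s a K z <= 64 / s * cmod (z - a) `^ s.
Proof.
move=> /andP[s0 s1] ha hz.
suff : dyadic_weight s a K z <= 64 / s * cmod (z - a) `^ s - cmod (z - a) ^+ 2.
  by have := sqr_ge0 (cmod (z - a)); lra.
have A64 : 64 <= 64 / s by rewrite ler_pdivlMr//; lra.
have q0 := powR_ge0 2 (- s).
have q1 : 2 `^ (- s) <= 1.
  rewrite powRN invr_le1 ?unitfE ?gt_eqF ?powR_gt0//.
  by rewrite -[leLHS](powRr0 2) ler_powR//; lra.
have q2 : 1 <= 2 * 2 `^ (- s).
  rewrite -{1}[2](@powRr1 _ 2)// -powRD ?pnatr_eq0 ?implybT//.
  by rewrite -[leLHS](powRr0 2) ler_powR//; lra.
elim: K z a ha hz => [|K IH] z a ha hz.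
  rewrite /dyadic_weight big_ord_recl big_ord0 addr0 expr0 mul1r expn0 !expr1.
  have := @sqr_le_powR (cmod (z - a)) s.
  rewrite cmod_ge0 cmod_unitB_le2// => /(_ isT); rewrite s0 ltW// => /(_ isT).
  have := powR_ge0 (cmod (z - a)) s; nra.
rewrite dyadic_weightS.
have := IH (z ^+ 2) (a ^+ 2); rewrite !cmodX ha hz expr1n => /(_ erefl erefl).
move=> /(ler_wpM2l q0); rewrite mulrBr mulrCA powR_doubling// cmod_sqrB//.
set d := cmod (z - a); set W := 2 `^ (- s) * _; set q := 2 `^ (- s) in q0 q1 q2 *.
have d0 : 0 <= d by exact: cmod_ge0.
have d2 : d <= 2 by exact: cmod_unitB_le2.
have h : (1 - d ^+ 2 / 4) `^ (s / 2) <= 1 - s / 2 * (d ^+ 2 / 4) / 2.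
  by apply: powR_1B_le; apply/andP; split; nra.
have p0 := powR_ge0 d s.
have p4 : d ^+ 2 <= 4 * d `^ s by apply: sqr_le_powR; apply/andP; split; lra.
have := ler_wpM2l p0 h.
set P := d `^ s in p0 p4 *; set X := _ `^ (s / 2).
move=> hX hW.
(* The constant 64/s makes the concavity gain equal to 64/s P (s d^2 / 16) = 4 P d^2, which is at
   least d^4. The square subtracted at the doubled point gives back 2 d^2 - d^4 or more, since q >=
   1/2. Together they absorb the new term d^2 and restore the subtracted square. *)
have hX' : 64 / s * (P * X) <= 64 / s * P - 4 * P * d ^+ 2.
  have : 64 / s * (P * X) <= 64 / s * (P * (1 - s / 2 * (d ^+ 2 / 4) / 2)).
    by rewrite ler_wpM2l// ltW// divr_gt0.
  have -> : 64 / s * (P * (1 - s / 2 * (d ^+ 2 / 4) / 2)) =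
    64 / s * P - 4 * P * d ^+ 2 by field; rewrite gt_eqF.
  by [].
have : d ^+ 4 <= 4 * P * d ^+ 2 by rewrite (exprM d 2 2) expr2; have := sqr_ge0 d; nra.
have : q * (d ^+ 2 * (4 - d ^+ 2)) >= 2 * d ^+ 2 - d ^+ 4.
  have -> : d ^+ 4 = d ^+ 2 * d ^+ 2 by rewrite -exprD.
  have : 0 <= d ^+ 2 by exact: sqr_ge0.
  have : d ^+ 2 <= 4 by nra.
  move: (d ^+ 2) => v v4 v0; nra.
lra.
Qed.

End PowerWeights.

(** * Weighted norms of trigonometric polynomials *)

Section WeightedNorm.
Variable R : realType.
Implicit Types (f g h : R -> R[i]) (V W : R -> R).
Let mu := @lebesgue_measure R.
Let D := @circle_dom R.

Lemma circle_dom_measurable :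
  measurable (@circle_dom R : set (measurableTypeR R)).
Proof. exact: measurable_itv. Qed.
Hint Resolve circle_dom_measurable : core.

Lemma circle_dom_measure : mu D = (2 * pi)%:E.
Proof.
by rewrite /D /mu lebesgue_measure_itv /= lte_fin mulr_gt0 ?pi_gt0// sube0.
Qed.

(** The measure is not normalized here. A divergent integral gets the value 0, so comparisons of
    norms are made under [sqint]. *)
Definition wnorm2 W f : R := \int[mu]_(t in D) (cmod (f t) ^+ 2 * W t).

Definition admissible W := measurable_fun D W /\
  exists2 M, 0 <= M & forall t, D t -> 0 <= W t <= M.

Definition sqint W f := cmeasurable f /\
  mu.-integrable D (EFin \o (fun t => cmod (f t) ^+ 2 * W t)).

Lemma measurable_cmod2 f : cmeasurable f ->
  measurable_fun D (fun t => cmod (f t) ^+ 2).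
Proof.
move=> [mr mi]; under eq_fun do rewrite cmodE2.
by apply: measurable_funD; exact: measurable_funX.
Qed.

Lemma cmeasurableD f g : cmeasurable f -> cmeasurable g ->
  cmeasurable (fun t => f t + g t).
Proof.
move=> [fr fi] [gr gi]; split.
  by under eq_fun do rewrite raddfD /=; exact: measurable_funD.
by under eq_fun do rewrite raddfD /=; exact: measurable_funD.
Qed.

Lemma cmeasurableM f g : cmeasurable f -> cmeasurable g ->
  cmeasurable (fun t => f t * g t).
Proof.
move=> [fr fi] [gr gi]; split.
  rewrite (_ : (fun _ => _) = fun t => complex.Re (f t) * complex.Re (g t) -
    complex.Im (f t) * complex.Im (g t)); last first.
    by apply/funext => t; case: (f t) => a b; case: (g t).
  by apply: measurable_funB; exact: measurable_funM.
rewrite (_ : (fun _ => _) = fun t => complex.Re (f t) * complex.Im (g t) +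
  complex.Im (f t) * complex.Re (g t)); last first.
  by apply/funext => t; case: (f t) => a b; case: (g t).
by apply: measurable_funD; exact: measurable_funM.
Qed.

Lemma cmeasurable_cst (c : R[i]) : cmeasurable (fun=> c).
Proof. by split; exact: measurable_cst. Qed.

Lemma cmeasurable_expi (k : R) : cmeasurable (fun t => expi (k * t)).
Proof.
by split; apply: measurable_funTS; apply: measurableT_comp;
  [apply: continuous_measurable_fun; exact: continuous_cos|exact: mulrl_measurable
  |apply: continuous_measurable_fun; exact: continuous_sin|exact: mulrl_measurable].
Qed.

Lemma cmeasurable_char (n : int) : cmeasurable (@char_circle R n).
Proof. exact: cmeasurable_expi. Qed.

Lemma measurable_cmod f : cmeasurable f -> measurable_fun D (fun t => cmod (f t)).
Proof.
move=> mf; rewrite (_ : (fun _ => _) = fun t => (cmod (f t) ^+ 2) `^ 2^-1).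
  apply: (@measurableT_comp _ _ _ _ _ _ (fun x : R => x `^ 2^-1)).
    exact: measurable_powR.
  exact: measurable_cmod2.
apply/funext => t; rewrite -powR_mulrn ?cmod_ge0// -powRrM divff//.
by rewrite powRr1 ?cmod_ge0.
Qed.

Lemma admissible_cst (c : R) : 0 <= c -> admissible (fun=> c).
Proof. by move=> c0; split; [exact: measurable_cst|exists c => // t _; rewrite c0 lexx]. Qed.

Lemma admissibleD V W : admissible V -> admissible W ->
  admissible (fun t => V t + W t).
Proof.
move=> [mV [M M0 hM]] [mW [N N0 hN]]; split; first exact: measurable_funD.
exists (M + N); first by rewrite addr_ge0.
by move=> t Dt; have /andP[? ?] := hM _ Dt; have /andP[? ?] := hN _ Dt;
  apply/andP; split; lra.
Qed.

Lemma admissibleM V W : admissible V -> admissible W ->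
  admissible (fun t => V t * W t).
Proof.
move=> [mV [M M0 hM]] [mW [N N0 hN]]; split; first exact: measurable_funM.
exists (M * N); first by rewrite mulr_ge0.
move=> t Dt; have /andP[? ?] := hM _ Dt; have /andP[? ?] := hN _ Dt.
by rewrite mulr_ge0//= ler_pM.
Qed.

Lemma admissible_bounded V (M : R) : measurable_fun D V ->
  (forall t, 0 <= V t <= M) -> admissible V.
Proof.
move=> mV hV; split => //; exists M => [|t _]; last exact: hV.
by have /andP[h1 h2] := hV 0; exact: le_trans h1 h2.
Qed.

Lemma measurable_integrand W f : measurable_fun D W -> cmeasurable f ->
  measurable_fun D (fun t => cmod (f t) ^+ 2 * W t).
Proof. by move=> mW mf; apply: measurable_funM => //; exact: measurable_cmod2. Qed.

Lemma bounded_sqint W f (M : R) : admissible W -> cmeasurable f ->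
  (forall t, cmod (f t) <= M) -> sqint W f.
Proof.
move=> [mW [N N0 hN]] mf hM; split => //.
apply: measurable_bounded_integrable => //.
- by rewrite [X in (X < _)%E]circle_dom_measure ltry.
- exact: measurable_integrand.
exists (M ^+ 2 * N); split; first exact: num_real.
move=> x hx t Dt; apply: le_trans (ltW hx).
have /andP[W0 WN] := hN _ Dt.
rewrite ger0_norm ?mulr_ge0 ?cmod_ge0//.
have c0 := cmod_ge0 (f t); have cM := hM t.
by apply: ler_pM => //; [exact: sqr_ge0|nra].
Qed.

Lemma wnorm2_ge0 W f : (forall t, D t -> 0 <= W t) -> 0 <= wnorm2 W f.
Proof.
by move=> W0; apply: Rintegral_ge0 => t Dt; rewrite mulr_ge0 ?sqr_ge0// W0.
Qed.

Lemma admissible_ge0 W t : admissible W -> D t -> 0 <= W t.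
Proof. by move=> [_ [M _ h]] Dt; have /andP[] := h _ Dt. Qed.

Lemma sqint_dom W V1 V2 f g h (C : R) :
  admissible W -> cmeasurable f -> sqint V1 g -> sqint V2 h ->
  (forall t, D t -> cmod (f t) ^+ 2 * W t <=
    C * (cmod (g t) ^+ 2 * V1 t + cmod (h t) ^+ 2 * V2 t)) -> sqint W f.
Proof.
move=> aW mf [mg ig] [mh ih] dom; split => //.
have i12 : mu.-integrable D (EFin \o (fun t =>
    C * (cmod (g t) ^+ 2 * V1 t + cmod (h t) ^+ 2 * V2 t))).
  have := integrableD circle_dom_measurable ig ih.
  by move=> /(integrableZl circle_dom_measurable C).
apply: le_integrable i12 => //.
  by apply/measurable_EFinP; apply: measurable_integrand => //; case: aW.
move=> t Dt /=; rewrite lee_fin (ger0_norm (mulr_ge0 (sqr_ge0 _) _)).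
  exact: le_trans (dom _ Dt) (ler_norm _).
exact: admissible_ge0.
Qed.

Lemma wnorm2_dom W V1 V2 f g h (C : R) :
  sqint W f -> sqint V1 g -> sqint V2 h ->
  (forall t, D t -> cmod (f t) ^+ 2 * W t <=
    C * (cmod (g t) ^+ 2 * V1 t + cmod (h t) ^+ 2 * V2 t)) ->
  wnorm2 W f <= C * (wnorm2 V1 g + wnorm2 V2 h).
Proof.
move=> [mf if_] [mg ig] [mh ih] dom.
have i12 := integrableD circle_dom_measurable ig ih.
rewrite /wnorm2 -RintegralD// -RintegralZl//.
apply: le_Rintegral => //.
by have := integrableZl circle_dom_measurable C i12.
Qed.

Lemma wnorm2_dom1 W V f g (C : R) :
  sqint W f -> sqint V g ->
  (forall t, D t -> cmod (f t) ^+ 2 * W t <= C * (cmod (g t) ^+ 2 * V t)) ->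
  wnorm2 W f <= C * wnorm2 V g.
Proof.
move=> [mf if_] [mg ig] dom.
rewrite /wnorm2 -RintegralZl//.
apply: le_Rintegral => //.
by have := integrableZl circle_dom_measurable C ig.
Qed.

Lemma eq_wnorm2 W f g : (forall t, cmod (f t) = cmod (g t)) ->
  wnorm2 W f = wnorm2 W g.
Proof. by move=> fg; apply: eq_Rintegral => t _ /=; rewrite fg. Qed.

End WeightedNorm.

(** * Trigonometric polynomials and orthogonality of the characters *)

Section TrigonometricPolynomials.
Variable R : realType.
Implicit Types (s : seq (int * R[i])) (m : int -> R[i]) (n k : int).
Let mu := @lebesgue_measure R.
Let D := @circle_dom R.
Hint Resolve circle_dom_measurable : core.

(* Repeated frequencies are allowed: [s] stands for [sum_(n, c) c e^{int}]. *)
Definition trigpoly s (t : R) : R[i] := \sum_(p <- s) p.2 * char_circle p.1 t.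

Definition coef s n : R[i] := \sum_(p <- s | p.1 == n) p.2.

Definition fmul m s := [seq (p.1, m p.1 * p.2) | p <- s].

Definition fshift k s := [seq (p.1 + k, p.2) | p <- s].

Lemma trigpoly_nil t : trigpoly [::] t = 0. Proof. exact: big_nil. Qed.

Lemma trigpoly_seq1 n t : trigpoly [:: (n, 1)] t = char_circle n t.
Proof. by rewrite /trigpoly big_seq1 mul1r. Qed.

Lemma trigpoly_cat s1 s2 t : trigpoly (s1 ++ s2) t = trigpoly s1 t + trigpoly s2 t.
Proof. exact: big_cat. Qed.

Lemma trigpoly_scale (a : R[i]) s t : trigpoly (fmul (fun=> a) s) t = a * trigpoly s t.
Proof.
by rewrite /trigpoly big_map big_distrr; apply: eq_bigr => p _ /=; rewrite mulrA.
Qed.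

Lemma trigpoly_shift k s t : trigpoly (fshift k s) t = char_circle k t * trigpoly s t.
Proof.
rewrite /trigpoly big_map big_distrr; apply: eq_bigr => p _ /=.
by rewrite char_circleD; ring.
Qed.

Lemma trigpoly_fmulD m1 m2 s t : trigpoly (fmul (fun n => m1 n + m2 n) s) t =
  trigpoly (fmul m1 s) t + trigpoly (fmul m2 s) t.
Proof.
rewrite /trigpoly !big_map -big_split; apply: eq_bigr => p _ /=.
by rewrite !mulrDl.
Qed.

Lemma fmul_cat m s1 s2 : fmul m (s1 ++ s2) = fmul m s1 ++ fmul m s2.
Proof. exact: map_cat. Qed.

Lemma fmul_comp m1 m2 s : fmul m1 (fmul m2 s) = fmul (fun n => m1 n * m2 n) s.
Proof. by rewrite /fmul -map_comp; apply: eq_map => p /=; rewrite mulrA. Qed.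

Lemma fmulC m1 m2 s : fmul m1 (fmul m2 s) = fmul m2 (fmul m1 s).
Proof. by rewrite !fmul_comp; apply: eq_map => p; rewrite (mulrC (m1 _)). Qed.

Lemma fmul_shift m k s : fmul m (fshift k s) = fshift k (fmul (fun n => m (n + k)) s).
Proof. by rewrite /fmul /fshift -!map_comp. Qed.

Lemma coef_cat s1 s2 n : coef (s1 ++ s2) n = coef s1 n + coef s2 n.
Proof. exact: big_cat. Qed.

Lemma coef_fmul m s n : coef (fmul m s) n = m n * coef s n.
Proof.
rewrite /coef big_map big_distrr.
by apply: eq_bigr => p /= /eqP ->.
Qed.

Lemma coef_shift k s n : coef (fshift k s) n = coef s (n - k).
Proof. by rewrite /coef big_map; apply: eq_bigl => p; rewrite /= eq_sym -subr_eq eq_sym. Qed.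

Lemma cmeasurable_trigpoly s : cmeasurable (trigpoly s).
Proof.
elim: s => [|p s IH].
  rewrite (_ : trigpoly _ = fun=> 0); first exact: cmeasurable_cst.
  by apply/funext => t; exact: big_nil.
rewrite (_ : trigpoly _ = fun t => p.2 * char_circle p.1 t + trigpoly s t).
  apply: cmeasurableD => //; apply: cmeasurableM; first exact: cmeasurable_cst.
  exact: cmeasurable_char.
by apply/funext => t; rewrite /trigpoly big_cons.
Qed.

Lemma trigpoly_bounded s t : cmod (trigpoly s t) <= \sum_(p <- s) cmod p.2.
Proof.
rewrite /trigpoly; elim/big_ind2 : _ => [|x1 x2 y1 y2 h1 h2|p _].
- by rewrite cmod0.
- by apply: le_trans (cmodD _ _) _; exact: lerD.
- by rewrite cmodM cmod_char_circle mulr1.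
Qed.

Lemma sqint_trigpoly W s : admissible W -> sqint W (trigpoly s).
Proof.
move=> aW; apply: bounded_sqint => //; first exact: cmeasurable_trigpoly.
by move=> t; exact: trigpoly_bounded.
Qed.

Lemma sqint_char W n : admissible W -> sqint W (@char_circle R n).
Proof.
move=> aW; have := sqint_trigpoly [:: (n, 1)] aW.
by rewrite (_ : trigpoly _ = char_circle n)//; apply/funext => t; rewrite trigpoly_seq1.
Qed.

Lemma char_circle_2pi n : @char_circle R n (2 * pi) = 1.
Proof.
have h (k : nat) : @char_circle R k%:Z (2 * pi) = 1.
  by rewrite char_circleX /expi mulrC mulr_natr cos2pi sin2pi expr1n.
case: n => k; first exact: h.
by rewrite NegzE char_circleN h; exact: conjc1.
Qed.

(** The real part with a complex coefficient [a] keeps all integrals real, and it is exactly the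
    cross term in the expansion of |sum|^2. *)
Lemma Rintegral_char (a : R[i]) n :
  mu.-integrable D (EFin \o (fun t => complex.Re (a * char_circle n t))) /\
  \int[mu]_(t in D) complex.Re (a * char_circle n t) =
    if n == 0 then 2 * pi * complex.Re a else 0.
Proof.
have icont : continuous (fun t : R => complex.Re (a * char_circle n t)).
  case: a => x y; rewrite /char_circle /= => t.
  apply: cvgB; apply: cvgM; try exact: cvg_cst.
    by apply: continuous_comp; [exact: mulrl_continuous|exact: continuous_cos].
  by apply: continuous_comp; [exact: mulrl_continuous|exact: continuous_sin].
have aint : mu.-integrable D (EFin \o (fun t => complex.Re (a * char_circle n t))).
  apply: measurable_bounded_integrable => //.
  - by rewrite [X in (X < _)%E]circle_dom_measure ltry.
  - by have [] := cmeasurableM (cmeasurable_cst a) (cmeasurable_char R n).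
  exists (cmod a); split; first exact: num_real.
  move=> x hx t _; apply: le_trans (ltW hx).
  have := cmod_Re_le (a * char_circle n t).
  by rewrite cmodM cmod_char_circle mulr1.
split => //; case: eqVneq => [->|n0].
  transitivity (\int[mu]_(t in D) (fun=> complex.Re a) t).
    by apply: eq_Rintegral => t _; rewrite char_circle0 mulr1.
  by rewrite Rintegral_cst// [X in fine X]circle_dom_measure mulrC.
have nR : n%:~R != 0 :> R by rewrite intr_eq0.
rewrite /D /circle_dom Rintegral_itv_bndo_bndc//.
pose F (t : R) := (complex.Re a * sin (n%:~R * t) + complex.Im a * cos (n%:~R * t)) / n%:~R.
have dF (t : R) : is_derive t 1 F (complex.Re (a * char_circle n t)).
  have -> : complex.Re (a * char_circle n t) =
    n%:~R^-1 *: (complex.Re a * (n%:~R * cos (n%:~R * t)) +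
    complex.Im a * (n%:~R * - sin (n%:~R * t))).
    by case: a {icont aint F} => x y /=; rewrite /GRing.scale /=; field.
  have -> : F = fun t => n%:~R^-1 *: (complex.Re a * sin (n%:~R * t) +
    complex.Im a * cos (n%:~R * t)).
    by apply/funext => u; rewrite /F mulrC.
  have dk : is_derive t 1 (fun u : R => n%:~R * u) n%:~R.
    by apply: is_derive_eq; rewrite /GRing.scale /= mulr1.
  apply: is_deriveZ; apply: is_deriveD; apply: is_deriveZ.
    by rewrite mulrC; apply: (is_derive1_comp (is_derive_sin _) dk).
  by rewrite mulrC; apply: (is_derive1_comp (is_derive_cos _) dk).
rewrite /Rintegral (@continuous_FTC2 _ _ F).
- rewrite /= /F !mulr0 sin0 cos0.
  have := char_circle_2pi n; rewrite /char_circle /expi => -[-> ->].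
  by rewrite subrr.
- by rewrite mulr_gt0 ?pi_gt0.
- exact: continuous_subspaceT.
- split.
  + by move=> t _; apply: ex_derive.
  + apply: cvg_at_right_filter; apply: differentiable_continuous.
    by apply/derivable1_diffP; apply: ex_derive.
  + apply: cvg_at_left_filter; apply: differentiable_continuous.
    by apply/derivable1_diffP; apply: ex_derive.
- by move=> t _; rewrite derive1E; apply: derive_val.
Qed.

End TrigonometricPolynomials.

(** * Parseval's identity and multipliers between weighted spaces *)

Section Parseval.
Variable R : realType.
Implicit Types (s : seq (int * R[i])) (m : int -> R[i]) (n k : int).
Implicit Types (U V W : R -> R).
Let mu := @lebesgue_measure R.
Let D := @circle_dom R.
Hint Resolve circle_dom_measurable : core.

Lemma Rintegral_sum_seq (I : Type) (r : seq I) (F : I -> R -> R) :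
  (forall i, mu.-integrable D (EFin \o F i)) ->
  mu.-integrable D (EFin \o (fun t => \sum_(i <- r) F i t)) /\
  \int[mu]_(t in D) (\sum_(i <- r) F i t) = \sum_(i <- r) \int[mu]_(t in D) F i t.
Proof.
move=> iF; elim: r => [|i r [IH1 IH2]].
  rewrite big_nil; under eq_fun do rewrite big_nil.
  split; last by rewrite Rintegral_cst// mul0r.
  exact: integrable0.
have E : (fun t => \sum_(j <- i :: r) F j t) =
    (fun t => F i t + \sum_(j <- r) F j t).
  by apply/funext => t; rewrite big_cons.
rewrite E big_cons; split; first by have := integrableD (@circle_dom_measurable R) (iF i) IH1.
by rewrite RintegralD// IH2.
Qed.

Lemma cmod2_sum (I : Type) (r : seq I) (P : pred I) (F : I -> R[i]) :
  cmod (\sum_(i <- r | P i) F i) ^+ 2 =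
  \sum_(i <- r | P i) \sum_(j <- r | P j) complex.Re (F i * (F j)^*).
Proof.
have -> : cmod (\sum_(i <- r | P i) F i) ^+ 2 = complex.Re
    ((\sum_(i <- r | P i) F i) * (\sum_(i <- r | P i) F i)^*).
  by rewrite mul_conjc.
rewrite rmorph_sum big_distrl raddf_sum; apply: eq_bigr => i _.
by rewrite big_distrr raddf_sum.
Qed.

(** The list [r] is left free so that several polynomials can be compared over one common set of
    frequencies. *)
Lemma parseval s (r : seq int) : uniq r -> {in s, forall p, p.1 \in r} ->
  wnorm2 (fun=> 1) (trigpoly s) = 2 * pi * \sum_(n <- r) cmod (coef s n) ^+ 2.
Proof.
move=> ur sr.
pose F (p q : int * R[i]) t := complex.Re (p.2 * (q.2)^* * char_circle (p.1 - q.1) t).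
have iF p q : mu.-integrable D (EFin \o F p q) by exact: (Rintegral_char _ _).1.
have -> : wnorm2 (fun=> 1) (trigpoly s) =
    \int[mu]_(t in D) \sum_(p <- s) \sum_(q <- s) F p q t.
  apply: eq_Rintegral => t _; rewrite mulr1 cmod2_sum.
  apply: eq_bigr => p _; apply: eq_bigr => q _.
  rewrite /F char_circleD char_circleN rmorphM /=; congr complex.Re; ring.
have [_ ->] := Rintegral_sum_seq s (fun p => (Rintegral_sum_seq s (iF p)).1).
under eq_bigr do rewrite (Rintegral_sum_seq s (iF _)).2.
under [in RHS]eq_bigr do rewrite cmod2_sum.
rewrite (eq_bigr (fun n => \sum_(p <- s) \sum_(q <- s)
   if (p.1 == n) && (q.1 == n) then complex.Re (p.2 * (q.2)^*) else 0)); last first.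
  move=> n _; rewrite big_mkcond; apply: eq_bigr => p _.
  by case: ifP => _ /=; [rewrite big_mkcond|rewrite big1].
rewrite [in RHS]exchange_big big_distrr /=; apply: eq_big_seq => p ps.
rewrite [in RHS]exchange_big big_distrr /=; apply: eq_big_seq => q qs.
rewrite (Rintegral_char _ _).2 subr_eq0 /=.
rewrite -big_mkcond /=; case: eqVneq => [e|ne].
  rewrite (eq_bigl (fun n => n == p.1)).
    by rewrite -big_filter filter_pred1_uniq ?sr// big_seq1.
  by move=> n; rewrite -e andbb eq_sym.
rewrite big_pred0 ?mulr0// => n.
by apply/negP => /andP[/eqP e1 /eqP e2]; move: ne; rewrite e1 e2 eqxx.
Qed.

Lemma trigpoly_eq0 s : (forall n, coef s n = 0) -> wnorm2 (fun=> 1) (trigpoly s) = 0.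
Proof.
move=> h; rewrite (@parseval s (undup [seq p.1 | p <- s])) ?undup_uniq//.
  by rewrite big1 ?mulr0// => n _; rewrite h cmod0 expr0n.
by move=> p ps; rewrite mem_undup map_f.
Qed.

(** The unweighted norm sees only the moduli of the coefficients. Every later replacement of a
    symbol by a majorant goes through this inequality. *)
Lemma wnorm2_coef_dom s s1 s2 (C : R) :
  (forall n, cmod (coef s n) ^+ 2 <=
    C * (cmod (coef s1 n) ^+ 2 + cmod (coef s2 n) ^+ 2)) ->
  wnorm2 (fun=> 1) (trigpoly s) <=
    C * (wnorm2 (fun=> 1) (trigpoly s1) + wnorm2 (fun=> 1) (trigpoly s2)).
Proof.
move=> h; pose r := undup ([seq p.1 | p <- s ++ s1 ++ s2]).
have ur : uniq r by exact: undup_uniq.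
have inr s' : {subset s' <= s ++ s1 ++ s2} -> {in s', forall p, p.1 \in r}.
  by move=> sub p ps; rewrite mem_undup map_f// sub.
rewrite (parseval ur (inr s _)); last by move=> p; rewrite mem_cat => ->.
rewrite (parseval ur (inr s1 _)); last by move=> p; rewrite !mem_cat => ->; rewrite orbT.
rewrite (parseval ur (inr s2 _)); last by move=> p; rewrite !mem_cat => ->; rewrite !orbT.
rewrite -mulrDr mulrCA ler_wpM2l ?mulr_ge0 ?pi_ge0//.
by rewrite -big_split big_distrr ler_sum.
Qed.

(** The inequality is between squared norms, so [C] stands for the square of an operator norm. *)
Definition bounded_mult U V m := exists2 C : R, 0 <= C &
  forall s, wnorm2 V (trigpoly (fmul m s)) <= C * wnorm2 U (trigpoly s).

Lemma bounded_mult_weaken U V U' V' m (C C' : R) :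
  admissible U -> admissible V -> admissible U' -> admissible V' ->
  0 <= C -> 0 <= C' ->
  (forall t, U t <= C * U' t) -> (forall t, V' t <= C' * V t) ->
  bounded_mult U V m -> bounded_mult U' V' m.
Proof.
move=> aU aV aU' aV' C0 C'0 UU' VV' [K K0 hK].
exists (C' * (K * C)); first by rewrite !mulr_ge0.
move=> s; apply: (@le_trans _ _ (C' * wnorm2 V (trigpoly (fmul m s)))).
  apply: wnorm2_dom1; try exact: sqint_trigpoly.
  by move=> t _; rewrite mulrCA ler_wpM2l ?sqr_ge0.
rewrite -!mulrA ler_wpM2l//; apply: le_trans (hK s) _; rewrite ler_wpM2l//.
apply: wnorm2_dom1; try exact: sqint_trigpoly.
by move=> t _; rewrite mulrCA ler_wpM2l ?sqr_ge0.
Qed.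

Lemma bounded_multD U V m1 m2 : admissible V ->
  bounded_mult U V m1 -> bounded_mult U V m2 ->
  bounded_mult U V (fun n => m1 n + m2 n).
Proof.
move=> aV [K K0 hK] [L L0 hL]; exists (2 * (K + L)); first by rewrite mulr_ge0 ?addr_ge0.
move=> s; apply: (@le_trans _ _ (2 * (wnorm2 V (trigpoly (fmul m1 s)) +
    wnorm2 V (trigpoly (fmul m2 s))))).
  apply: wnorm2_dom; try exact: sqint_trigpoly.
  move=> t Dt; rewrite trigpoly_fmulD -mulrDl mulrA ler_wpM2r ?cmod_sqD//.
  exact: admissible_ge0 Dt.
by rewrite -mulrA ler_wpM2l// mulrDl lerD.
Qed.

Lemma bounded_mult_comp U V W m1 m2 :
  bounded_mult U V m1 -> bounded_mult V W m2 -> bounded_mult U W (fun n => m2 n * m1 n).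
Proof.
move=> [K K0 hK] [L L0 hL]; exists (L * K); first by rewrite mulr_ge0.
move=> s; rewrite -fmul_comp -mulrA; apply: le_trans (hL _) _.
by rewrite ler_wpM2l.
Qed.

Lemma bounded_mult_cst U (c : R[i]) : admissible U -> bounded_mult U U (fun=> c).
Proof.
move=> aU; exists (cmod c ^+ 2); first exact: sqr_ge0.
move=> s; apply: wnorm2_dom1; try exact: sqint_trigpoly.
by move=> t _; rewrite trigpoly_scale cmodM exprMn mulrA.
Qed.

Lemma bounded_mult1 m (M : R) : (forall n, cmod (m n) <= M) ->
  bounded_mult (fun=> 1) (fun=> 1) m.
Proof.
move=> hM; exists (M ^+ 2); first exact: sqr_ge0.
move=> s; have := @wnorm2_coef_dom (fmul m s) s [::] (M ^+ 2).
rewrite (@trigpoly_eq0 [::]) ?addr0; last by move=> n; exact: big_nil.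
apply => n; rewrite coef_fmul cmodM exprMn [coef [::] n]big_nil cmod0 expr0n addr0.
have := hM n; have := cmod_ge0 (m n) => h1 h2.
by rewrite ler_wpM2r ?sqr_ge0//; nra.
Qed.

Lemma bounded_mult_dom U m m1 m2 (C : R) : 0 <= C ->
  (forall n, cmod (m n) <= C * (cmod (m1 n) + cmod (m2 n))) ->
  bounded_mult U (fun=> 1) m1 -> bounded_mult U (fun=> 1) m2 ->
  bounded_mult U (fun=> 1) m.
Proof.
move=> C0 hm [K K0 hK] [L L0 hL]; exists (2 * C ^+ 2 * (K + L)).
  by rewrite !mulr_ge0 ?sqr_ge0 ?addr_ge0.
move=> s; have := @wnorm2_coef_dom (fmul m s) (fmul m1 s) (fmul m2 s) (2 * C ^+ 2).
move=> /(_ _)/le_trans; apply.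
  move=> n; rewrite !coef_fmul !cmodM !exprMn -mulrDl mulrA ler_wpM2r ?sqr_ge0//.
  have := hm n; have := cmod_ge0 (m n); have := cmod_ge0 (m1 n); have := cmod_ge0 (m2 n).
  move: (cmod (m n)) (cmod (m1 n)) (cmod (m2 n)) => x y z z0 y0 x0 h.
  apply: (@le_trans _ _ ((C * (y + z)) ^+ 2)); first by nra.
  have -> : 2 * C ^+ 2 * (y ^+ 2 + z ^+ 2) =
    (C * (y + z)) ^+ 2 + (C * (y - z)) ^+ 2 by ring.
  by rewrite lerDl sqr_ge0.
by rewrite -[leRHS]mulrA ler_wpM2l ?mulr_ge0 ?sqr_ge0// mulrDl lerD.
Qed.

Lemma wnorm2_shift W k s : wnorm2 W (trigpoly (fshift k s)) = wnorm2 W (trigpoly s).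
Proof.
by apply: eq_wnorm2 => t; rewrite trigpoly_shift cmodM cmod_char_circle mul1r.
Qed.

(** Translating the symbol is conjugation by the modulation e^{ikt}, an isometry for every
    weight. *)
Lemma bounded_mult_translate U V m k : bounded_mult U V m ->
  bounded_mult U V (fun n => m (n + k)).
Proof.
move=> [K K0 hK]; exists K => // s.
have := hK (fshift k s).
by rewrite fmul_shift !wnorm2_shift.
Qed.

(* Multiplication of the kernel by [z - a], up to the choice of indexing. *)
Definition kernel_zero (a : R[i]) m : int -> R[i] := fun n => m (n - 1) - a * m n.

Lemma kernel_zeroC a b m n :
  kernel_zero a (kernel_zero b m) n = kernel_zero b (kernel_zero a m) n.
Proof. by rewrite /kernel_zero; ring. Qed.

Lemma bounded_mult_kernel_zero U V m a : admissible V -> bounded_mult U V m ->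
  bounded_mult U V (kernel_zero a m).
Proof.
move=> aV Bm; apply: bounded_multD => //; first exact: bounded_mult_translate.
have := bounded_mult_comp Bm (bounded_mult_cst (- a) aV).
by under eq_fun do rewrite mulNr.
Qed.

(* With [x], [y] the output and input variables, the kernel factor [x/y - a] is
   [(x - a b)/y + a (b/y - 1)]: its first part gains a zero of the weight at
   the output, its second part a zero at the input. *)
Lemma bounded_mult_gain U V U' V' U'' m (a b : R[i]) (C1 C2 C3 : R) :
  admissible U -> admissible V -> admissible U' -> admissible V' ->
  admissible U'' -> cmod a = 1 ->
  0 <= C1 -> 0 <= C2 -> 0 <= C3 ->
  (forall t, cmod (expi t - a * b) ^+ 2 * V' t <= C1 * V t) ->
  (forall t, U t <= C2 * U' t) ->
  (forall t, cmod (expi t - b) ^+ 2 * U'' t <= C3 * U' t) ->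
  bounded_mult U V m -> bounded_mult U'' V' m ->
  bounded_mult U' V' (kernel_zero a m).
Proof.
move=> aU aV aU' aV' aU'' ca C10 C20 C30 hV hU hU'' [K K0 hK] [L L0 hL].
exists (2 * (C1 * (K * C2) + L * C3)).
  by rewrite mulr_ge0// addr_ge0// !mulr_ge0.
move=> s.
(* If [s] stands for f, then [s1] stands for f/y and [s2] for (b/y - 1) f: the two inputs in the
   splitting of the kernel factor. *)
pose s1 := fshift (- 1) s.
pose s2 := fmul (fun=> b) s1 ++ fmul (fun=> - 1) s.
have e1 t : trigpoly (fmul (kernel_zero a m) s) t =
    (expi t - a * b) * trigpoly (fmul m s1) t + a * trigpoly (fmul m s2) t.
  rewrite /s2 fmul_cat trigpoly_cat ![fmul m (fmul _ _)]fmulC !trigpoly_scale.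
  have -> : fmul m s1 = fshift (- 1) (fmul (fun n => m (n - 1)) s).
    exact: fmul_shift.
  rewrite trigpoly_shift.
  have -> : fmul (kernel_zero a m) s =
    fmul (fun n => m (n - 1) + - a * m n) s.
    by apply: eq_map => p; rewrite /kernel_zero mulNr.
  rewrite trigpoly_fmulD -fmul_comp trigpoly_scale.
  have : expi t * char_circle (- 1) t = 1.
    by rewrite -[expi t]char_circle1 -char_circleD subrr char_circle0.
  move: (expi t) (char_circle _ t) (trigpoly _ t) (trigpoly _ t) => x y p q xy.
  have -> : (x - a * b) * (y * q) = (x * y) * q - a * b * y * q by ring.
  by rewrite xy; ring.
have e2 t : cmod (trigpoly s2 t) = cmod (expi t - b) * cmod (trigpoly s t).
  rewrite trigpoly_cat !trigpoly_scale trigpoly_shift mulN1r.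
  rewrite -[trigpoly s t in X in _ + X]mul1r mulrA -mulrBl cmodM; congr (_ * _).
  have : cmod (expi t) = 1 by exact: cmod_expi.
  have : expi t * char_circle (- 1) t = 1.
    by rewrite -[expi t]char_circle1 -char_circleD subrr char_circle0.
  move: (expi t) (char_circle _ t) => x y xy cx.
  by rewrite -[LHS]mul1r -cx -cmodM mulrBr mulrCA xy !mulr1 cmod_distC.
apply: (@le_trans _ _ (2 * (wnorm2 (fun t => C1 * V t) (trigpoly (fmul m s1)) +
   wnorm2 V' (trigpoly (fmul m s2))))).
  have aC1V : admissible (fun t => C1 * V t).
    by apply: admissibleM => //; exact: admissible_cst.
  apply: wnorm2_dom; try exact: sqint_trigpoly.
  move=> t Dt; rewrite e1.
  have V0 : 0 <= V' t by exact: admissible_ge0 Dt.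
  apply: (@le_trans _ _ (2 * (cmod ((expi t - a * b) * trigpoly (fmul m s1) t) ^+ 2 +
    cmod (a * trigpoly (fmul m s2) t) ^+ 2) * V' t)).
    by rewrite ler_wpM2r// cmod_sqD.
  rewrite -mulrA ler_wpM2l// mulrDl !cmodM ca mul1r lerD2r exprMn mulrAC.
  by rewrite mulrC ler_wpM2l ?sqr_ge0.
rewrite -mulrA ler_wpM2l// mulrDl lerD//.
  apply: (@le_trans _ _ (C1 * wnorm2 V (trigpoly (fmul m s1)))).
    apply: wnorm2_dom1; try exact: sqint_trigpoly.
      by apply: sqint_trigpoly; apply: admissibleM => //; exact: admissible_cst.
    by move=> t _; rewrite mulrCA.
  rewrite -!mulrA ler_wpM2l//; apply: le_trans (hK _) _; rewrite ler_wpM2l//.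
  rewrite wnorm2_shift; apply: wnorm2_dom1; try exact: sqint_trigpoly.
  by move=> t _; rewrite mulrCA ler_wpM2l ?sqr_ge0.
apply: le_trans (hL _) _; rewrite -mulrA ler_wpM2l//.
apply: wnorm2_dom1; try exact: sqint_trigpoly.
move=> t _; rewrite e2 exprMn mulrAC [leRHS]mulrCA [leLHS]mulrC.
by rewrite ler_wpM2l ?sqr_ge0.
Qed.

End Parseval.

(** * Weights with one zero and Lipschitz functions of their multipliers *)

Section FractionalWeights.
Variable R : realType.
Implicit Types (f g h : seq (int * R[i])) (m : int -> R[i]) (n : int) (s theta : R).
Let mu := @lebesgue_measure R.
Let D := @circle_dom R.
Hint Resolve circle_dom_measurable : core.

Lemma cmeasurable_expiB theta : cmeasurable (fun t : R => expi t - expi theta).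
Proof.
apply: cmeasurableD (cmeasurable_cst _).
rewrite (_ : @expi R = char_circle 1); first exact: cmeasurable_char.
by apply/funext => t; rewrite char_circle1.
Qed.

Lemma cmod_expiB_le2 (s t : R) : 0 <= cmod (expi t - expi s) <= 2.
Proof. by rewrite cmod_ge0 cmod_unitB_le2 ?cmod_expi. Qed.

Definition pow_weight s theta (t : R) : R := cmod (expi t - expi theta) `^ s.

Lemma pow_weight_bounds s theta t : 0 < s <= 1 -> 0 <= pow_weight s theta t <= 4.
Proof. by move=> hs; rewrite powR_ge0 powR_le4// cmod_expiB_le2. Qed.

Lemma admissible_pow_weight s theta : 0 < s <= 1 -> admissible (pow_weight s theta).
Proof.
move=> hs; apply: (@admissible_bounded _ _ 4) => [|t]; last exact: pow_weight_bounds.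
apply: (@measurableT_comp _ _ _ _ _ _ (fun x : R => x `^ s)).
  exact: measurable_powR.
apply: (@measurable_cmod _ (fun t => expi t - expi theta)).
exact: cmeasurable_expiB.
Qed.

Lemma admissible_dyadic_weight s theta K :
  admissible (fun t => dyadic_weight s (expi theta) K (expi t)).
Proof.
have term (c : R) k : 0 <= c -> admissible (fun t : R =>
    c * cmod (expi t ^+ k - expi theta ^+ k) ^+ 2).
  move=> c0; apply: (@admissible_bounded _ _ (c * 4)) => [|t].
    apply: measurable_funM; first exact: measurable_cst.
    apply: measurable_cmod2; apply: cmeasurableD (cmeasurable_cst _).
    rewrite (_ : (fun t => _) = char_circle k); first exact: cmeasurable_char.
    by apply/funext => t; rewrite char_circleX.
  rewrite mulr_ge0 ?sqr_ge0//= ler_wpM2l//.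
  have := @cmod_unitB_le2 R (expi t ^+ k) (expi theta ^+ k).
  rewrite !cmodX !cmod_expi !expr1n => /(_ erefl erefl).
  by have := cmod_ge0 (expi t ^+ k - expi theta ^+ k); nra.
rewrite /dyadic_weight; elim: K => [|K IH].
  under eq_fun do rewrite big_ord_recl big_ord0 addr0.
  by apply: term; rewrite exprn_ge0// powR_ge0.
under eq_fun do rewrite big_ord_recr /=.
by apply: admissibleD => //; apply: term; rewrite exprn_ge0// powR_ge0.
Qed.

Definition twisted_diff theta (k : nat) f :=
  fshift (2 ^ k)%N%:Z f ++ fmul (fun=> - (expi theta ^+ (2 ^ k))) f.

Lemma trigpoly_twisted_diff theta k f t : trigpoly (twisted_diff theta k f) t =
  (expi t ^+ (2 ^ k) - expi theta ^+ (2 ^ k)) * trigpoly f t.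
Proof.
by rewrite trigpoly_cat trigpoly_shift trigpoly_scale char_circleX -mulrDl.
Qed.

Lemma coef_twisted_diff theta k f n : coef (twisted_diff theta k f) n =
  coef f (n - (2 ^ k)%N%:Z) - expi theta ^+ (2 ^ k) * coef f n.
Proof. by rewrite coef_cat coef_shift coef_fmul mulNr. Qed.

(** Each dyadic term is the squared modulus of a polynomial, which can be moved into f. The weighted
    norm becomes a sum of unweighted ones, open to Parseval. *)
Lemma wnorm2_dyadic s theta K f :
  wnorm2 (fun t => dyadic_weight s (expi theta) K (expi t)) (trigpoly f) =
  \sum_(k < K.+1) (2 `^ (- s)) ^+ k *
    wnorm2 (fun=> 1) (trigpoly (twisted_diff theta k f)).
Proof.
have a1 : admissible (fun=> 1 : R) by exact: admissible_cst.
have i1 k := (sqint_trigpoly (twisted_diff theta k f) a1).2.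
pose F (k : 'I_K.+1) t := (2 `^ (- s)) ^+ k *
  (cmod (trigpoly (twisted_diff theta k f) t) ^+ 2 * 1).
transitivity (\int[mu]_(t in D) \sum_(k < K.+1) F k t).
  apply: eq_Rintegral => t _; rewrite /dyadic_weight big_distrr.
  apply: eq_bigr => k _ /=.
  by rewrite /F mulr1 trigpoly_twisted_diff cmodM exprMn; ring.
have iF k : mu.-integrable D (EFin \o F k).
  by have := integrableZl (@circle_dom_measurable R) ((2 `^ (- s)) ^+ k) (i1 k).
rewrite (Rintegral_sum_seq _ iF).2; apply: eq_bigr => k _.
by rewrite /F RintegralZl//; exact: i1.
Qed.

Lemma le_of_geometric_error (x y c q : R) : 0 <= q < 1 -> 0 <= c ->
  (forall K, x <= y + c * q ^+ K) -> x <= y.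
Proof.
move=> /andP[q0 q1] c0 h; apply/ler_addgt0Pr => e e0.
have : (fun n : nat => q ^+ n) @ \oo --> (0 : R) by apply: cvg_expr; rewrite ger0_norm.
move=> /cvgrPdist_lt/(_ (e / (c + 1))) h0.
have : 0 < e / (c + 1) by rewrite divr_gt0//; lra.
move=> /h0[N _ /(_ N (leqnn N))] /=; rewrite sub0r normrN ger0_norm ?exprn_ge0//.
rewrite ltr_pdivlMr; last by lra.
have := h N; have := exprn_ge0 N q0; move: (q ^+ N) => p; nra.
Qed.

(** A comparison at each dyadic scale is summed up to K. For fixed [f] the truncation error is
    geometric in K and vanishes in the limit. Two angles are allowed so that rotations of the weight
    are covered too. *)
Lemma pow_weight_comparison s theta theta' f g h (C : R) : 0 < s < 1 -> 0 <= C ->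
  (forall k, wnorm2 (fun=> 1) (trigpoly (twisted_diff theta k f)) <=
    C * (wnorm2 (fun=> 1) (trigpoly (twisted_diff theta' k g)) +
         wnorm2 (fun=> 1) (trigpoly (twisted_diff theta' k h)))) ->
  wnorm2 (pow_weight s theta) (trigpoly f) <=
    C * (64 / s) * (wnorm2 (pow_weight s theta') (trigpoly g) +
                    wnorm2 (pow_weight s theta') (trigpoly h)).
Proof.
move=> hs C0 dom; have /andP[s0 s1] := hs.
have a1 : admissible (fun=> 1 : R) by exact: admissible_cst.
have hs1 : 0 < s <= 1 by rewrite s0 ltW.
have ap u : admissible (pow_weight s u) by exact: admissible_pow_weight.
have ad u K := admissible_dyadic_weight s u K.
have q0 : 0 <= 2 `^ (- s) :> R by exact: powR_ge0.
have q1 : 2 `^ (- s) < 1 :> R.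
  rewrite powRN invf_lt1 ?powR_gt0// -[ltLHS](powRr0 2) /powR pnatr_eq0 /=.
  by rewrite ltr_expR mul0r mulr_gt0// ln_gt0// ltr1n.
have N0 f' : 0 <= wnorm2 (fun=> 1) (trigpoly f') by exact: wnorm2_ge0.
have up g' K : wnorm2 (fun t => dyadic_weight s (expi theta') K (expi t)) (trigpoly g')
    <= 64 / s * wnorm2 (pow_weight s theta') (trigpoly g').
  apply: wnorm2_dom1; try exact: sqint_trigpoly.
  by move=> t _; rewrite mulrCA ler_wpM2l ?sqr_ge0// dyadic_le_pow ?cmod_expi.
apply: (@le_of_geometric_error _ _ (4 * 2 `^ (- s) *
    wnorm2 (fun=> 1) (trigpoly f)) (2 `^ (- s))).
- by rewrite q0.
- by rewrite !mulr_ge0.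
move=> K.
apply: (@le_trans _ _ (wnorm2 (fun t => dyadic_weight s (expi theta) K (expi t)) (trigpoly f) +
   4 * 2 `^ (- s) ^+ K.+1 * wnorm2 (fun=> 1) (trigpoly f))).
  have -> : 4 * 2 `^ (- s) ^+ K.+1 * wnorm2 (fun=> 1) (trigpoly f) =
     wnorm2 (fun=> 4 * 2 `^ (- s) ^+ K.+1) (trigpoly f).
    rewrite /wnorm2 -RintegralZl//; last exact: (sqint_trigpoly f a1).2.
    by apply: eq_Rintegral => t _; rewrite mulr1 mulrC.
  rewrite -[leRHS]mul1r.
  apply: wnorm2_dom; try exact: sqint_trigpoly.
    by apply/sqint_trigpoly/admissible_cst; rewrite mulr_ge0// exprn_ge0.
  move=> t _; rewrite mul1r -mulrDr ler_wpM2l ?sqr_ge0//.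
  by rewrite pow_le_dyadic ?cmod_expi.
have -> : 4 * 2 `^ (- s) ^+ K.+1 * wnorm2 (fun=> 1) (trigpoly f) =
  4 * 2 `^ (- s) * wnorm2 (fun=> 1) (trigpoly f) * 2 `^ (- s) ^+ K.
  by rewrite exprS; ring.
rewrite lerD2r -mulrA mulrDr.
apply: le_trans (ler_wpM2l C0 (lerD (up g K) (up h K))).
rewrite !wnorm2_dyadic -big_split big_distrr; apply: ler_sum => k _ /=.
by rewrite -mulrDr mulrCA ler_wpM2l ?exprn_ge0.
Qed.

(** A Leibniz rule for twisted differences: the difference of G(m) c is G(m) times the difference of
    c, plus the increment of G(m) times c. The second part is at most L times the increment of m
    times c, which the differences of c and of m c control. Hence the majorants [f] and
    [fmul m f]. *)
Lemma bounded_mult_lipschitz s theta m (G : R[i] -> R[i]) (M M' L : R) :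
  0 < s < 1 -> 0 <= L ->
  (forall n, cmod (m n) <= M) -> (forall x, cmod (G x) <= M') ->
  (forall x y, cmod (G x - G y) <= L * cmod (x - y)) ->
  bounded_mult (pow_weight s theta) (pow_weight s theta) m ->
  bounded_mult (pow_weight s theta) (pow_weight s theta) (fun n => G (m n)).
Proof.
move=> hs L0 hM hM' hL [K K0 hK]; have /andP[s0 s1] := hs.
have M0 : 0 <= M by exact: le_trans (cmod_ge0 _) (hM 0).
have M'0 : 0 <= M' by exact: le_trans (cmod_ge0 _) (hM' 0).
pose C := 2 * ((M' + L * M) ^+ 2 + L ^+ 2).
have C0 : 0 <= C by rewrite mulr_ge0// addr_ge0// sqr_ge0.
exists (C * (64 / s) * (1 + K)).
  by rewrite mulr_ge0 ?addr_ge0// mulr_ge0// divr_ge0// ltW.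
move=> f.
apply: le_trans (@pow_weight_comparison s theta theta _ f (fmul m f) C hs C0 _) _.
  move=> k; apply: wnorm2_coef_dom => n.
  rewrite !coef_twisted_diff !coef_fmul.
  have : cmod (expi theta ^+ (2 ^ k)) = 1 by rewrite cmodX cmod_expi expr1n.
  set n' := n - _; move: (expi theta ^+ _) (coef f n') (coef f n) => a c c' ca.
  set X := cmod (c - a * c'); set Y := cmod (m n' * c - a * (m n * c')).
  have X0 : 0 <= X by exact: cmod_ge0.
  have Y0 : 0 <= Y by exact: cmod_ge0.
  have h1 : cmod (m n' - m n) * cmod c' <= Y + M * X.
    have -> : cmod (m n' - m n) * cmod c' =
        cmod ((m n' * c - a * (m n * c')) - m n' * (c - a * c')).
      rewrite -[LHS]mul1r -ca -!cmodM; congr cmod; ring.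
    apply: le_trans (cmodB _ _) _; rewrite lerD2l cmodM.
    by rewrite ler_wpM2r.
  have h2 : cmod (G (m n') * c - a * (G (m n) * c')) <= (M' + L * M) * X + L * Y.
    have -> : G (m n') * c - a * (G (m n) * c') =
        G (m n') * (c - a * c') + a * ((G (m n') - G (m n)) * c') by ring.
    apply: le_trans (cmodD _ _) _; rewrite !cmodM ca mul1r.
    apply: (@le_trans _ _ (M' * X + L * cmod (m n' - m n) * cmod c')).
      by rewrite lerD// ler_wpM2r// cmod_ge0.
    rewrite -mulrA; have := ler_wpM2l L0 h1; lra.
  have h3 := cmod_ge0 (G (m n') * c - a * (G (m n) * c')).
  apply: (@le_trans _ _ (((M' + L * M) * X + L * Y) ^+ 2)); first by nra.
  rewrite /C; set p := M' + L * M.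
  have -> : 2 * (p ^+ 2 + L ^+ 2) * (X ^+ 2 + Y ^+ 2) = (p * X + L * Y) ^+ 2 +
    ((p * X - L * Y) ^+ 2 + 2 * (p * Y) ^+ 2 + 2 * (L * X) ^+ 2) by ring.
  by rewrite lerDl !addr_ge0 ?sqr_ge0// pmulr_rge0 ?sqr_ge0.
rewrite -[leRHS]mulrA ler_wpM2l//; first by rewrite mulr_ge0// divr_ge0// ltW.
by rewrite mulrDl mul1r lerD2l.
Qed.

(* [f(t + theta)] has the Fourier coefficients of [f] up to unimodular factors. *)
Lemma bounded_mult_rotate s theta m : 0 < s < 1 ->
  bounded_mult (pow_weight s 0) (fun=> 1) m ->
  bounded_mult (pow_weight s theta) (fun=> 1) m.
Proof.
move=> hs [K K0 hK]; have /andP[s0 s1] := hs.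
exists (K * (1 * (64 / s) * 2)).
  by rewrite !mulr_ge0// invr_ge0 ltW.
have half (x : R) : x = 2^-1 * (x + x) by field.
move=> f; pose f' := fmul (fun n => char_circle n theta) f.
apply: (@le_trans _ _ (2^-1 * (wnorm2 (fun=> 1) (trigpoly (fmul m f')) +
    wnorm2 (fun=> 1) (trigpoly (fmul m f'))))).
  apply: wnorm2_coef_dom => n; rewrite /f' !coef_fmul !cmodM cmod_char_circle mul1r.
  by rewrite -half.
rewrite -half.
apply: le_trans (hK _) _; rewrite -[leRHS]mulrA ler_wpM2l//.
have -> : 1 * (64 / s) * 2 * wnorm2 (pow_weight s theta) (trigpoly f) =
  1 * (64 / s) * (wnorm2 (pow_weight s theta) (trigpoly f) +
    wnorm2 (pow_weight s theta) (trigpoly f)) by ring.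
apply: pow_weight_comparison => // k; apply: wnorm2_coef_dom => n.
rewrite !coef_twisted_diff !coef_fmul expi0 expr1n !mul1r.
have e : char_circle n theta =
    char_circle (n - (2 ^ k)%N%:Z) theta * expi theta ^+ (2 ^ k).
  by rewrite -char_circleX -char_circleD subrK.
rewrite [X in _ - X * _]e -mulrA -mulrBr cmodM cmod_char_circle mul1r.
by rewrite lerDl sqr_ge0.
Qed.

End FractionalWeights.

(** * Inverting a symbol *)

Section InverseMultiplier.
Variable R : realType.
Implicit Types (f g : seq (int * R[i])) (m lambda : int -> R[i]) (n : int).
Implicit Types (U V W : R -> R).

(* A Lipschitz extension of [z |-> 1 / z] from [cmod z >= h]. *)
Definition clipped_inv (h : R) (z : R[i]) : R[i] :=
  z^* * ((Num.max (cmod z) h) ^- 2)%:C.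

Lemma clipped_invE h z : 0 < h -> h <= cmod z -> z * clipped_inv h z = 1.
Proof.
move=> h0 hz; rewrite mulrA mul_conjc -rmorphM /= max_l//.
by rewrite mulfV// expf_neq0// gt_eqF// (lt_le_trans h0).
Qed.

Lemma cmod_clipped_inv_le h z : 0 < h -> cmod (clipped_inv h z) <= h^-1.
Proof.
move=> h0; rewrite cmodM cmod_conjc cmod_real.
set r := Num.max _ _.
have rh : h <= r by rewrite le_max lexx orbT.
have rz : cmod z <= r by rewrite le_max lexx.
have r0 : 0 < r by exact: lt_le_trans h0 rh.
rewrite ger0_norm ?invr_ge0 ?sqr_ge0//.
apply: (@le_trans _ _ (r * r ^- 2)); first by rewrite ler_wpM2r// invr_ge0 sqr_ge0.
rewrite (_ : r * r ^- 2 = r^-1); last by field; rewrite gt_eqF.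
by rewrite lef_pV2.
Qed.

Lemma clipped_inv_lipschitz h x y : 0 < h ->
  cmod (clipped_inv h x - clipped_inv h y) <= 3 / h ^+ 2 * cmod (x - y).
Proof.
move=> h0; rewrite /clipped_inv.
set r := Num.max (cmod x) h; set s := Num.max (cmod y) h.
have rh : h <= r by rewrite le_max lexx orbT.
have rx : cmod x <= r by rewrite le_max lexx.
have sh : h <= s by rewrite le_max lexx orbT.
have r0 : 0 < r by exact: lt_le_trans h0 rh.
have s0 : 0 < s by exact: lt_le_trans h0 sh.
have rs : `|s - r| <= cmod (x - y).
  apply: le_trans (cmod_dist_ge x y); rewrite /r /s.
  by case: (leP (cmod x) h) => ?; case: (leP (cmod y) h) => ?;
    rewrite ler_norml; case: (ler0P (cmod x - cmod y)) => ?; apply/andP; split; lra.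
(* Changing the numerator costs 1/h^2. Changing the radius costs r (s + r) / (r^2 s^2) <= 2/h^2,
   because |x| <= r and the clipped radius is 1-Lipschitz. *)
have -> : x^* * (r ^- 2)%:C - y^* * (s ^- 2)%:C =
    (x - y)^* * (s ^- 2)%:C + x^* * (r ^- 2 - s ^- 2)%:C.
  by rewrite !rmorphB /=; ring.
apply: le_trans (cmodD _ _) _; rewrite !cmodM !cmod_conjc !cmod_real.
rewrite [`|s ^- 2|]ger0_norm ?invr_ge0 ?sqr_ge0//.
have e : r ^- 2 - s ^- 2 = (s - r) * ((s + r) / (r ^+ 2 * s ^+ 2)).
  by field; rewrite !gt_eqF.
rewrite e normrM; set q := (s + r) / _.
have q0 : 0 <= q by rewrite ltW// divr_gt0 ?addr_gt0 ?mulr_gt0 ?exprn_gt0.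
rewrite (ger0_norm q0).
have d0 : 0 <= `|s - r| by [].
have -> : 3 / h ^+ 2 * cmod (x - y) =
  cmod (x - y) * h ^- 2 + cmod (x - y) * (2 * h ^- 2) by ring.
have hinv u : h <= u -> u ^- 2 <= h ^- 2.
  move=> hu; rewrite lef_pV2 ?posrE ?exprn_gt0//; last exact: lt_le_trans h0 hu.
  by rewrite lerXn2r// nnegrE ltW// (lt_le_trans h0).
apply: lerD; first by rewrite ler_wpM2l ?cmod_ge0// hinv.
rewrite mulrCA.
apply: ler_pM => //; first by rewrite mulr_ge0 ?cmod_ge0.
apply: (@le_trans _ _ (r * q)); first by rewrite ler_wpM2r.
have -> : r * q = r^-1 * s^-1 + s ^- 2 by rewrite /q; field; rewrite !gt_eqF.
have -> : 2 * h ^- 2 = h^-1 * h^-1 + h ^- 2 by field; rewrite gt_eqF.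
have iV u : h <= u -> u^-1 <= h^-1.
  by move=> hu; rewrite lef_pV2// posrE (lt_le_trans h0).
by rewrite lerD ?hinv// ler_pM ?invr_ge0 ?iV// ltW.
Qed.

Lemma cmod_kernel_zero_le a m (M : R) : cmod a = 1 -> (forall n, cmod (m n) <= M) ->
  forall n, cmod (kernel_zero a m n) <= 2 * M.
Proof.
move=> ca hm n; apply: le_trans (cmodB _ _) _.
by rewrite cmodM ca mul1r; have := hm n; have := hm (n - 1); lra.
Qed.

Lemma bounded_multZ U V m (c : R[i]) : admissible V ->
  bounded_mult U V m -> bounded_mult U V (fun n => c * m n).
Proof. by move=> aV Bm; exact: bounded_mult_comp Bm (bounded_mult_cst c aV). Qed.

(** This is b (z - a) - b (z - 1) = 1 for b = 1 / (1 - a), with [p] in the place of z and [q] in the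
    place of 1: the identity is read after a multiplier has been applied. *)
Let split_identity (a b p q : R[i]) : (1 - a) * b = 1 ->
  q = b * p + b * (- a * q) + (- b * p + - b * (-1 * q)).
Proof.
move=> h; have -> : b * p + b * (- a * q) + (- b * p + - b * (-1 * q)) =
  (1 - a) * b * q by ring.
by rewrite h mul1r.
Qed.

Variables (alpha beta theta : R).
Hypotheses (ha1 : 0 < alpha < 1) (hb1 : 0 < beta < 1) (alpha_le_beta : alpha <= beta).
Hypothesis sin_neq0 : sin theta != 0.

Let one_weight : R -> R := fun=> 1.
Let w1 := pow_weight beta 0.
Let w2 := pow_weight alpha theta.
Let w (t : R) := w1 t * w2 t.
Let zeta := expi theta.
Let zeta' := expi (- theta).

Let hb : 0 < beta <= 1.
Proof. by case/andP: hb1 => -> /ltW. Qed.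
Let ha : 0 < alpha <= 1.
Proof. by case/andP: ha1 => -> /ltW. Qed.

Let a1 : admissible one_weight. Proof. exact: admissible_cst. Qed.
Let aw1 : admissible w1. Proof. exact: admissible_pow_weight. Qed.
Let aw2 : admissible w2. Proof. exact: admissible_pow_weight. Qed.

Lemma admissible_two_zeros : admissible w. Proof. exact: admissibleM. Qed.
Let aw := admissible_two_zeros.

Let w1_ge0 t : 0 <= w1 t. Proof. exact: powR_ge0. Qed.
Let w2_ge0 t : 0 <= w2 t. Proof. exact: powR_ge0. Qed.
Let w1_le t : w1 t <= 4 * one_weight t.
Proof. by rewrite mulr1; have /andP[] := pow_weight_bounds 0 t hb. Qed.
Let w2_le t : w2 t <= 4 * one_weight t.
Proof. by rewrite mulr1; have /andP[] := pow_weight_bounds theta t ha. Qed.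
Let w_le1 t : w t <= 4 * w1 t.
Proof. by rewrite /w mulrC ler_wpM2r//; have := w2_le t; rewrite mulr1. Qed.
Let w_le2 t : w t <= 4 * w2 t.
Proof. by rewrite ler_wpM2r//; have := w1_le t; rewrite mulr1. Qed.
Let sq1 t : cmod (expi t - 1) ^+ 2 <= 4 * w1 t.
Proof. by rewrite -expi0 sqr_le_powR// cmod_expiB_le2. Qed.
Let sq2 t : cmod (expi t - zeta) ^+ 2 <= 4 * w2 t.
Proof. by rewrite sqr_le_powR// cmod_expiB_le2. Qed.
Let sq1w t : cmod (expi t - 1) ^+ 2 * w2 t <= 4 * w t.
Proof. by rewrite mulrA ler_wpM2r. Qed.
Let sq2w t : cmod (expi t - zeta) ^+ 2 * w1 t <= 4 * w t.
Proof. by rewrite [w t]mulrC mulrA ler_wpM2r. Qed.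

Let zetaK : zeta' * zeta = 1.
Proof. by rewrite -expiD addNr expi0. Qed.
Let cz : cmod zeta = 1. Proof. exact: cmod_expi. Qed.
Let cz' : cmod zeta' = 1. Proof. exact: cmod_expi. Qed.
Let zeta_neq1 : 1 - zeta != 0.
Proof.
apply: contra sin_neq0; rewrite subr_eq0 => /eqP e.
by have := congr1 (@complex.Im R) e => /= <-.
Qed.
Let zeta'_neq1 : 1 - zeta' != 0.
Proof.
apply: contra sin_neq0; rewrite subr_eq0 => /eqP e.
by have := congr1 (@complex.Im R) e; rewrite /= sinN => /esym/eqP; rewrite oppr_eq0.
Qed.
Let zeta_neq : zeta - zeta' != 0.
Proof.
apply: contra sin_neq0; rewrite subr_eq0 => /eqP e.
have := congr1 (@complex.Im R) e; rewrite /= sinN => h.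
by apply/eqP; lra.
Qed.

(** Write f = c (z - zeta) f - c (z - 1) f. The first part is controlled in L^2(w1) by the norm of f
    in L^2(w), since its factor z - zeta supplies the missing [w2]. The second part is likewise
    controlled in L^2(w2). *)
Lemma bounded_mult_split V m : admissible V ->
  bounded_mult w1 V m -> bounded_mult w2 V m -> bounded_mult w V m.
Proof.
move=> aV [K K0 hK] [L L0 hL].
pose c := (1 - zeta)^-1; pose C := 4 * cmod c ^+ 2.
have C0 : 0 <= C by rewrite mulr_ge0// sqr_ge0.
exists (2 * (K * C + L * C)); first by rewrite mulr_ge0// addr_ge0// mulr_ge0.
move=> f.
pose f1 := fmul (fun=> c) (fshift 1 f ++ fmul (fun=> - zeta) f).
pose f2 := fmul (fun=> - c) (fshift 1 f ++ fmul (fun=> - 1) f).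
have e1 t : trigpoly f1 t = c * (expi t - zeta) * trigpoly f t.
  rewrite trigpoly_scale trigpoly_cat trigpoly_shift trigpoly_scale char_circle1.
  by ring.
have e2 t : trigpoly f2 t = - c * (expi t - 1) * trigpoly f t.
  rewrite trigpoly_scale trigpoly_cat trigpoly_shift trigpoly_scale char_circle1.
  by ring.
have e t : trigpoly (fmul m f) t = trigpoly (fmul m f1) t + trigpoly (fmul m f2) t.
  rewrite /f1 /f2 (fmulC m (fun=> c)) (fmulC m (fun=> - c)) !fmul_cat.
  rewrite (fmulC m (fun=> - zeta)) (fmulC m (fun=> - 1)).
  rewrite !trigpoly_cat !trigpoly_scale.
  move: (trigpoly (fmul m (fshift _ _)) t) (trigpoly _ t) => p q.
  by apply: split_identity; rewrite mulfV.
apply: (@le_trans _ _ (2 * (wnorm2 V (trigpoly (fmul m f1)) +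
    wnorm2 V (trigpoly (fmul m f2))))).
  apply: wnorm2_dom; try exact: sqint_trigpoly.
  move=> t Dt; rewrite e -mulrDl mulrA ler_wpM2r ?cmod_sqD//.
  exact: admissible_ge0 Dt.
rewrite -[leRHS]mulrA ler_wpM2l// mulrDl lerD//.
  apply: le_trans (hK _) _; rewrite -mulrA ler_wpM2l//.
  apply: wnorm2_dom1; try exact: sqint_trigpoly.
  move=> t _; rewrite e1 !cmodM !exprMn.
  have := ler_wpM2l (mulr_ge0 (sqr_ge0 (cmod c)) (sqr_ge0 (cmod (trigpoly f t)))) (sq2w t).
  by rewrite /C; lra.
apply: le_trans (hL _) _; rewrite -mulrA ler_wpM2l//.
apply: wnorm2_dom1; try exact: sqint_trigpoly.
move=> t _; rewrite e2 !cmodM cmodN !exprMn.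
have := ler_wpM2l (mulr_ge0 (sqr_ge0 (cmod c)) (sqr_ge0 (cmod (trigpoly f t)))) (sq1w t).
by rewrite /C; lra.
Qed.

Lemma bounded_mult_inverse lambda (M delta : R) : 0 < delta ->
  (forall n, cmod (lambda n) <= M) -> (forall n, delta <= cmod (lambda n)) ->
  bounded_mult w w lambda -> bounded_mult w w (fun n => (lambda n)^-1).
Proof.
move=> delta0 hM hdelta Bl.
have M0 : 0 <= M by exact: le_trans (cmod_ge0 _) (hM 0).
have cone : cmod (1 : R[i]) = 1 by exact: cmod1.
have lipschitz1 m G N N' L := @bounded_mult_lipschitz R beta 0 m G N N' L hb1.
have lipschitz2 m G N N' L := @bounded_mult_lipschitz R alpha theta m G N N' L ha1.
rewrite -/w1 -/w2 in lipschitz1 lipschitz2.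
(* Here alpha <= beta enters: |z - zeta|^beta <= 4 |z - zeta|^alpha, so an input bound with exponent
   beta at zeta implies the one for [w2]. *)
have rotate m : bounded_mult w1 one_weight m -> bounded_mult w2 one_weight m.
  move=> /(bounded_mult_rotate theta hb1).
  apply: (@bounded_mult_weaken _ _ _ _ _ _ 4 1 (admissible_pow_weight theta hb)
    a1 aw2 a1 (ler0n R 4) ler01).
  - move=> t; apply: powR_le_exponent; rewrite ?cmod_expiB_le2//.
      by case/andP: ha => ->.
    by case/andP: hb.
  - by move=> t; rewrite mul1r.
clearbody aw; clearbody w1 w2 w zeta zeta'.
have B11 m N : (forall n, cmod (m n) <= N) -> bounded_mult one_weight one_weight m.
  exact: bounded_mult1.
have B1w1 m N : (forall n, cmod (m n) <= N) -> bounded_mult one_weight w1 m.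
  move=> /B11; apply: (@bounded_mult_weaken _ _ _ _ _ _ 1 4) => // t.
  by rewrite mul1r.
have B1w2 m N : (forall n, cmod (m n) <= N) -> bounded_mult one_weight w2 m.
  move=> /B11; apply: (@bounded_mult_weaken _ _ _ _ _ _ 1 4) => // t.
  by rewrite mul1r.
(* A kernel zero at a and an input zero at b put the output zero at a b. Here b = 1 is paid for by
   [w1], and the output zero at zeta completes [w1] to [w]. *)
have A1 : bounded_mult w1 w1 (kernel_zero zeta lambda).
  apply: (@bounded_mult_gain _ w w w1 w1 one_weight lambda zeta 1 4 4 4) => //.
  - by move=> t; rewrite mulr1.
  - by move=> t; rewrite mulr1.
  - exact: B1w1 hM.
have A2 : bounded_mult w2 w2 (kernel_zero zeta' lambda).
  apply: (@bounded_mult_gain _ w w w2 w2 one_weight lambda zeta' zeta 4 4 4) => //.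
  - by move=> t; rewrite zetaK.
  - by move=> t; rewrite mulr1.
  - exact: B1w2 hM.
pose la := kernel_zero zeta' (kernel_zero zeta lambda).
have La1 : bounded_mult w1 w1 la by exact: bounded_mult_kernel_zero.
have La2 : bounded_mult w2 w2 la.
  rewrite (_ : la = kernel_zero zeta (kernel_zero zeta' lambda)).
    exact: bounded_mult_kernel_zero.
  by apply/funext => n; exact: kernel_zeroC.
pose E := kernel_zero 1 lambda.
have hE : forall n, cmod (E n) <= 2 * M by exact: cmod_kernel_zero_le.
(* The kernel zero at 1 puts the output zero at the same point as the input zero. The output weight
   can then drop its zero at 1 and keep the one at zeta; [E21] exchanges the roles. *)
have E12 : bounded_mult w1 w2 E.
  apply: (@bounded_mult_gain _ w w w1 w2 one_weight lambda 1 1 4 4 4) => //.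
  - by move=> t; rewrite mulr1.
  - by move=> t; rewrite mulr1.
  - exact: B1w2 hM.
have E21 : bounded_mult w2 w1 E.
  apply: (@bounded_mult_gain _ w w w2 w1 one_weight lambda 1 zeta 4 4 4) => //.
  - by move=> t; rewrite mul1r.
  - by move=> t; rewrite mulr1.
  - exact: B1w1 hM.
(* The output is already in L^2(w2), and the further zero at zeta removes this last weight. *)
have R2 : bounded_mult w1 one_weight (kernel_zero zeta E).
  apply: (@bounded_mult_gain _ w1 w2 w1 one_weight one_weight E zeta 1 4 1 4) => //.
  - by move=> t; rewrite !mulr1.
  - by move=> t; rewrite mul1r.
  - by move=> t; rewrite mulr1.
  - exact: B11 hE.
have R1a : bounded_mult w1 w2 (kernel_zero zeta' E) by exact: bounded_mult_kernel_zero.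
have R1b : bounded_mult w2 one_weight (kernel_zero zeta' E).
  apply: (@bounded_mult_gain _ w2 w1 w2 one_weight one_weight E zeta' zeta 4 1 4) => //.
  - by move=> t; rewrite zetaK mulr1.
  - by move=> t; rewrite mul1r.
  - by move=> t; rewrite mulr1.
  - exact: B11 hE.
(* The Lagrange coefficients: the three quadratic kernel factors, weighted by them, add up to the
   constant 1. *)
pose c0 := ((1 - zeta) * (1 - zeta'))^-1.
pose c1 := ((zeta - 1) * (zeta - zeta'))^-1.
pose c2 := ((zeta' - 1) * (zeta' - zeta))^-1.
pose l0 n := c0 * la n.
pose r1 n := c1 * kernel_zero zeta' E n.
pose r2 n := c2 * kernel_zero zeta E n.
have decomp n : lambda n = l0 n + r1 n + r2 n.
  rewrite /l0 /r1 /r2 /la /E /kernel_zero /c0 /c1 /c2.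
  move: (lambda n) (lambda (n - 1)) (lambda (n - 1 - 1)) => x y z.
  have n1 : zeta - 1 != 0 by rewrite -oppr_eq0 opprB.
  have n2 : zeta' - 1 != 0 by rewrite -oppr_eq0 opprB.
  have n3 : zeta' - zeta != 0 by rewrite -oppr_eq0 opprB.
  by field; rewrite n1 n2 n3 zeta_neq zeta_neq1 zeta'_neq1.
(* Half of the lower bound, so that at each index either |l0| >= h, where [Lam] inverts [l0], or
   |lambda - l0| >= h. *)
pose h := delta / 2; have h0 : 0 < h by rewrite divr_gt0.
pose Lam n := clipped_inv h (l0 n).
have hla n : cmod (la n) <= 2 * (2 * M).
  by apply: cmod_kernel_zero_le => //; exact: cmod_kernel_zero_le.
have hl0 n : cmod (l0 n) <= cmod c0 * (2 * (2 * M)).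
  by rewrite cmodM ler_wpM2l ?cmod_ge0.
have lip : 0 <= 3 / h ^+ 2 by rewrite divr_ge0// sqr_ge0.
have Lam1 : bounded_mult w1 w1 Lam.
  apply: (@lipschitz1 l0 (clipped_inv h) _ h^-1 _ lip hl0).
  - by move=> x; exact: cmod_clipped_inv_le.
  - by move=> x y; exact: clipped_inv_lipschitz.
  - exact: bounded_multZ.
have Lam2 : bounded_mult w2 w2 Lam.
  apply: (@lipschitz2 l0 (clipped_inv h) _ h^-1 _ lip hl0).
  - by move=> x; exact: cmod_clipped_inv_le.
  - by move=> x y; exact: clipped_inv_lipschitz.
  - exact: bounded_multZ.
have LamW : bounded_mult w w Lam.
  apply: bounded_mult_split => //.
    by apply: (@bounded_mult_weaken _ _ _ _ _ _ 1 4 _ _ _ _ _ _ _ _ Lam1) => // t;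
      rewrite mul1r.
  by apply: (@bounded_mult_weaken _ _ _ _ _ _ 1 4 _ _ _ _ _ _ _ _ Lam2) => // t;
    rewrite mul1r.
pose sigma n := (1 - lambda n * Lam n) ^+ 2 / lambda n.
have lneq0 n : lambda n != 0 by rewrite -cmod_gt0 (lt_le_trans delta0).
have -> : (fun n => (lambda n)^-1) =
    (fun n => Lam n * (2 + (- 1) * (lambda n * Lam n)) + sigma n).
  by apply/funext => n; rewrite /sigma; field.
apply: bounded_multD => //.
  apply: (bounded_mult_comp _ LamW); apply: bounded_multD => //.
    exact: bounded_mult_cst.
  by apply: bounded_multZ => //; exact: bounded_mult_comp LamW Bl.
(* If |l0| >= h, the residual is (l0 - lambda) Lam. Otherwise it is at most 1 + M/h, and |lambda -
   l0| / h >= 1 lets the same bound hold. *)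
have rest n : cmod (1 - lambda n * Lam n) <=
    (1 + M / h) / h * (cmod (r1 n) + cmod (r2 n)).
  have hr : cmod (lambda n - l0 n) <= cmod (r1 n) + cmod (r2 n).
    rewrite decomp; move: (l0 n) (r1 n) (r2 n) => x y z.
    have -> : x + y + z - x = y + z by ring.
    exact: cmodD.
  apply: (@le_trans _ _ ((1 + M / h) / h * cmod (lambda n - l0 n))); last first.
    by rewrite ler_wpM2l// divr_ge0 ?addr_ge0 ?divr_ge0// ltW.
  have LamB : cmod (Lam n) <= h^-1 by exact: cmod_clipped_inv_le.
  have Mh0 : 0 <= M / h by rewrite divr_ge0// ltW.
  have [hl|hl] := leP h (cmod (l0 n)).
    rewrite -(clipped_invE h0 hl) -mulrBl cmodM cmod_distC mulrC ler_wpM2r ?cmod_ge0//.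
    apply: le_trans LamB _; rewrite ler_pdivlMr// mulVf ?gt_eqF//.
    by rewrite lerDl.
  have hd : h <= cmod (lambda n - l0 n).
    have := cmodD (lambda n - l0 n) (l0 n); rewrite subrK.
    have := hdelta n; rewrite /h in hl *; lra.
  apply: (@le_trans _ _ (1 + M / h)).
    apply: le_trans (cmodB _ _) _; rewrite cmod1 lerD2l cmodM.
    by rewrite ler_pM ?cmod_ge0.
  rewrite -mulrA -[leLHS]mulr1 ler_wpM2l ?addr_ge0//.
  by rewrite mulrC ler_pdivlMr// mul1r.
have Bsigma1 : bounded_mult w1 one_weight sigma.
  set K := (1 + M / h) / h in rest.
  have K0 : 0 <= K by rewrite divr_ge0 ?addr_ge0 ?divr_ge0// ltW.
  pose N := cmod c2 * (2 * (2 * M)).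
  have hr2 n : cmod (r2 n) <= N.
    by rewrite cmodM ler_wpM2l ?cmod_ge0//; exact: cmod_kernel_zero_le.
  have N0 : 0 <= N by exact: le_trans (cmod_ge0 _) (hr2 0).
  have Br1 : bounded_mult w1 one_weight (fun n => r1 n * r1 n).
    by apply: (@bounded_mult_comp _ w1 w2); exact: bounded_multZ.
  have Br2 : bounded_mult w1 one_weight r2 by exact: bounded_multZ.
  (* From (x + y)^2 <= 2 (x^2 + y^2) and y^2 <= N y: [r1] is needed squared, whereas [r2] may enter
     linearly because it is bounded. *)
  apply: (@bounded_mult_dom _ _ _ (fun n => r1 n * r1 n) r2 (2 * K ^+ 2 / delta * (1 + N))) => //.
    rewrite mulr_ge0 ?addr_ge0// divr_ge0//; last exact: ltW.
    by rewrite pmulr_rge0 ?sqr_ge0.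
  move=> n; rewrite /sigma cmodM cmodV cmodX cmodM.
  have x0 := cmod_ge0 (r1 n); have y0 := cmod_ge0 (r2 n); have yN := hr2 n.
  have e0 := cmod_ge0 (1 - lambda n * Lam n); have he := rest n.
  move: (cmod (r1 n)) (cmod (r2 n)) (cmod (1 - _)) x0 y0 yN e0 he => x y e x0 y0 yN e0 he.
  apply: (@le_trans _ _ (e ^+ 2 / delta)).
    by rewrite ler_wpM2l ?sqr_ge0// lef_pV2 ?posrE// (lt_le_trans delta0).
  rewrite [leRHS](_ : _ = 2 * K ^+ 2 * ((1 + N) * (x * x + y)) / delta); last by ring.
  rewrite ler_pM2r ?invr_gt0//.
  apply: (@le_trans _ _ ((K * (x + y)) ^+ 2)); first by nra.
  have -> : 2 * K ^+ 2 * ((1 + N) * (x * x + y)) =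
    K ^+ 2 * (2 * ((1 + N) * (x * x + y))) by ring.
  rewrite exprMn ler_wpM2l ?sqr_ge0//.
  have h1 : 0 <= N * (x * x) by apply: mulr_ge0 => //; exact: mulr_ge0.
  have h2 : y * y <= N * y by rewrite ler_wpM2r.
  clearbody N; have := sqr_ge0 (x - y); nra.
(* The target L^2 embeds in L^2(w) because w <= 16. Inputs in L^2(w2) are reached by rotating the
   bound for [w1]. *)
apply: bounded_mult_split => //.
  by apply: (@bounded_mult_weaken _ _ _ _ _ _ 1 16 _ _ _ _ _ _ _ _ Bsigma1) => // t;
    rewrite ?mul1r//; have := w_le1 t; have := w1_le t; rewrite /one_weight; lra.
by apply: (@bounded_mult_weaken _ _ _ _ _ _ 1 16 _ _ _ _ _ _ _ _ (rotate _ Bsigma1)) => // t;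
  rewrite ?mul1r//; have := w_le1 t; have := w1_le t; rewrite /one_weight; lra.
Qed.

End InverseMultiplier.

(** * Extension to all of L^2(w) *)

Section Completeness.
Variable R : realType.
Implicit Types (f g h : R -> R[i]) (W : R -> R).
Let mu := @lebesgue_measure R.
Let D := @circle_dom R.
Hint Resolve circle_dom_measurable : core.

Lemma sqintP W f : admissible W -> cmeasurable f ->
  sqint W f <-> (\int[mu]_(t in D) (cmod (f t) ^+ 2 * W t)%:E < +oo)%E.
Proof.
move=> aW mf; have E : (\int[mu]_(t in D) `|(cmod (f t) ^+ 2 * W t)%:E| =
    \int[mu]_(t in D) (cmod (f t) ^+ 2 * W t)%:E)%E.
  apply: eq_integral => t; rewrite inE => Dt /=.
  by rewrite ger0_norm// mulr_ge0 ?sqr_ge0// (admissible_ge0 aW Dt).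
split=> [[_ /integrableP[_]]|]; rewrite /= ?E// => h.
split => //; apply/integrableP; split; last by rewrite /= E.
by apply/measurable_EFinP; apply: measurable_integrand => //; case: aW.
Qed.

Lemma wnorm2_EFin W f : sqint W f ->
  (wnorm2 W f)%:E = (\int[mu]_(t in D) (cmod (f t) ^+ 2 * W t)%:E)%E.
Proof. by move=> [_ fi]; rewrite /wnorm2 /Rintegral fineK//; exact: integrable_fin_num. Qed.

Lemma cvg_of_geometric_sq (a : nat -> R) (B : R) :
  (forall n m, (n <= m)%N -> (a m - a n) ^+ 2 <= B * 2^-1 ^+ n) -> cvgn a.
Proof.
move=> h; apply/cauchy_cvgP/cauchy_ballP => e e0; near_simpl.
suff : \forall x & x' \near \oo, (x' <= x)%N -> ball (a x) e (a x').
  move=> /[dup]; rewrite {1}near_swap; apply: filter_app2; near=> n m.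
  by have /orP[mn /(_ mn)/ball_sym + _| ? _] := leq_total n m; apply.
near=> n m; move=> /= mn; rewrite /ball /=.
have : B * 2^-1 ^+ m < e ^+ 2.
  apply: le_lt_trans (ler_norm _) _; near: m.
  have : geometric B (2^-1 : R) @ \oo --> (0 : R).
    by apply: cvg_geometric; rewrite ger0_norm// invf_lt1// ltr1n.
  by move=> /cvgr0_norm_lt; apply; rewrite exprn_gt0.
move=> /(le_lt_trans (h _ _ mn)) he.
by rewrite -ltr_sqr ?nnegrE ?(ltW e0)// real_normK ?num_real.
Unshelve. all: by end_near. Qed.

(** Each use of |x + y|^2 <= 2 (|x|^2 + |y|^2) doubles the weight of the remaining increments, hence
    the factors 2^i. *)
Lemma telescope_cmod2 (z : nat -> R[i]) n k :
  cmod (z (n + k)%N - z n) ^+ 2 <=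
  2 * 2^-1 ^+ n * \sum_(n <= i < n + k) 2 ^+ i * cmod (z i.+1 - z i) ^+ 2.
Proof.
elim: k n => [|k IH] n.
  by rewrite addn0 subrr cmod0 expr0n big_geq// mulr0.
have -> : z (n + k.+1)%N - z n = (z n.+1 - z n) + (z (n.+1 + k)%N - z n.+1).
  by rewrite addSnnS; ring.
apply: le_trans (cmod_sqD _ _) _.
rewrite big_ltn ?addnS ?ltnS ?leq_addr//.
rewrite -addSn [leRHS]mulrDr.
have -> : 2 * 2^-1 ^+ n * (2 ^+ n * cmod (z n.+1 - z n) ^+ 2) =
    2 * cmod (z n.+1 - z n) ^+ 2.
  by rewrite -!mulrA; congr (_ * _); rewrite mulrA -exprMn mulVf// expr1n mul1r.
rewrite mulrDr lerD2l; apply: le_trans (ler_wpM2l _ (IH n.+1)) _ => //.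
by rewrite exprS le_eqVlt; apply/orP; left; apply/eqP; field.
Qed.

Lemma limn_esup_fine_cvg (a : nat -> R) : cvgn a ->
  a @ \oo --> fine (limn_esup (fun n => (a n)%:E)).
Proof.
move=> /cvg_ex[l al]; have : (fun n => (a n)%:E) @ \oo --> l%:E.
  by apply: cvg_EFin => //; exact: nearW.
by move=> /cvg_limn_einf_sup[_ ->].
Qed.

(* Riesz-Fischer, for a sequence that converges fast. The pointwise limit is
   controlled by the integrable series [S = sum_n 2^n |u_(n+1) - u_n|^2 W]. *)
Lemma sqint_complete W (u : nat -> R -> R[i]) (A : R) : admissible W ->
  (forall n, sqint W (u n)) -> 0 <= A ->
  (forall n, wnorm2 W (fun t => u n.+1 t - u n t) <= A * 4^-1 ^+ n) ->
  exists g B, [/\ sqint W g, 0 <= B &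
    forall n, wnorm2 W (fun t => g t - u n t) <= B * 2^-1 ^+ n].
Proof.
move=> aW su A0 hu.
have mN f : cmeasurable f -> cmeasurable (fun t => - f t).
  move=> mf; have := cmeasurableM (cmeasurable_cst (-1 : R[i])) mf.
  by under eq_fun do rewrite mulN1r.
have mu_ n : cmeasurable (u n) by exact: (su n).1.
have mB f n : cmeasurable f -> cmeasurable (fun t => f t - u n t).
  by move=> mf; apply: cmeasurableD => //; exact: mN.
have sd n : sqint W (fun t => u n.+1 t - u n t).
  apply: (@sqint_dom _ _ _ _ _ _ _ 2 aW _ (su n.+1) (su n)); first exact: mB.
  move=> t Dt; rewrite -mulrDl mulrA ler_wpM2r ?(admissible_ge0 aW Dt)//.
  by rewrite -(cmodN (u n t)) cmod_sqD.
pose f n t : R := 2 ^+ n * (cmod (u n.+1 t - u n t) ^+ 2 * W t).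
have f0 n t : D t -> 0 <= f n t.
  move=> Dt; rewrite mulr_ge0 ?exprn_ge0// mulr_ge0 ?sqr_ge0//.
  exact: admissible_ge0 aW Dt.
have fm n : measurable_fun D (fun t => (f n t)%:E).
  apply/measurable_EFinP; apply: measurable_funM; first exact: measurable_cst.
  by apply: measurable_integrand; [case: aW|exact: mB].
pose S t := (\sum_(n <oo) (f n t)%:E)%E.
have S0 t : D t -> (0 <= S t)%E.
  by move=> Dt; apply: nneseries_ge0 => n _ _; rewrite lee_fin f0.
have mS : measurable_fun D S.
  have := @ge0_emeasurable_sum _ _ R D (fun n t => (f n t)%:E) xpredT.
  by apply => // n t Dt _; rewrite lee_fin f0.
(* The integral of S is at most the sum of 2^n A 4^(-n), that is 2 A. *)
have intS : (\int[mu]_(t in D) S t < +oo)%E.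
  rewrite integral_nneseries//.
  apply: (@le_lt_trans _ _ (2 * A)%:E); last exact: ltry.
  apply: lime_le.
    apply: is_cvg_nneseries => n _ _; apply: integral_ge0 => t Dt.
    by rewrite lee_fin f0.
  apply: nearW => n.
  have -> : (\sum_(0 <= i < n) \int[mu]_(t in D) (f i t)%:E)%E =
      (\sum_(0 <= i < n) 2 ^+ i * wnorm2 W (fun t => u i.+1 t - u i t))%:E.
    rewrite -sumEFin; apply: eq_bigr => i _.
    rewrite EFinM wnorm2_EFin// -ge0_integralZl_EFin ?exprn_ge0//.
      by move=> t Dt; rewrite lee_fin mulr_ge0 ?sqr_ge0// (admissible_ge0 aW Dt).
    apply/measurable_EFinP.
    by apply: measurable_integrand; [case: aW|exact: mB].
  rewrite lee_fin; apply: (@le_trans _ _ (2 * A - 2 * A * 2^-1 ^+ n)); last first.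
    by rewrite gerBl mulr_ge0 ?exprn_ge0 ?mulr_ge0 ?invr_ge0.
  elim: n => [|n IH]; first by rewrite big_geq// expr0 mulr1 subrr.
  rewrite big_nat_recr//=; apply: (le_trans (lerD IH (ler_wpM2l _ (hu n)))).
    by rewrite exprn_ge0.
  rewrite mulrCA -exprMn (_ : 2 / 4 = 2^-1 :> R); last by field.
  by rewrite exprS le_eqVlt; apply/orP; left; apply/eqP; field.
have partial n k t : D t -> ((\sum_(n <= i < n + k) f i t)%:E <= S t)%E.
  move=> Dt; rewrite -sumEFin.
  apply: le_trans (nneseries_lim_ge (n + k) _); last by move=> i _ _; rewrite lee_fin f0.
  rewrite [leRHS](big_cat_nat _ (n := n))//= ?leq_addr//.
  by rewrite leeDr// sume_ge0// => i _; rewrite lee_fin f0.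
(* Upper limits are measurable whether or not the sequence converges, and they agree with the limit
   wherever it does. *)
pose g t : R[i] := fine (limn_esup (fun n => (complex.Re (u n t))%:E)) +i*
  fine (limn_esup (fun n => (complex.Im (u n t))%:E)).
have mg : cmeasurable g.
  split; apply: (@measurableT_comp _ _ _ _ _ _ fine) => //;
    apply: measurable_fun_limn_esup => n; apply/measurable_EFinP;
    [exact: (mu_ n).1|exact: (mu_ n).2].
have key n t : D t -> ((cmod (g t - u n t) ^+ 2 * W t)%:E <=
    (2 * 2^-1 ^+ n)%:E * S t)%E.
  move=> Dt; have c0 k : 0 < 2 * 2^-1 ^+ k :> R by rewrite mulr_gt0 ?exprn_gt0.
  have W0 := admissible_ge0 aW Dt.
  have := S0 _ Dt; have := fun n k => partial n k t Dt.
  case: (S t) => [r hp r0|_ _|//]; last by rewrite gt0_muley ?lte_fin// leey.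
  rewrite -EFinM lee_fin.
  have [->|Wn0] := eqVneq (W t) 0; first by rewrite mulr0 mulr_ge0// ltW.
  have Wp : 0 < W t by rewrite lt_def Wn0.
  pose b := 2 * r / W t.
  have hb k m : (k <= m)%N -> cmod (u m t - u k t) ^+ 2 <= b * 2^-1 ^+ k.
    move=> km; rewrite -(subnKC km).
    apply: le_trans (telescope_cmod2 (fun i => u i t) _ _) _.
    have := hp k (m - k)%N; rewrite lee_fin.
    rewrite (_ : \sum_(k <= i < k + (m - k)) f i t = (\sum_(k <= i < k + (m - k))
      2 ^+ i * cmod (u i.+1 t - u i t) ^+ 2) * W t); last first.
      by rewrite big_distrl; apply: eq_bigr => i _ /=; rewrite /f mulrA.
    rewrite -ler_pdivlMr// => /(ler_wpM2l (ltW (c0 k)))/le_trans; apply.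
    by rewrite /b le_eqVlt; apply/orP; left; apply/eqP; field.
  have hre k m : (k <= m)%N ->
      (complex.Re (u m t) - complex.Re (u k t)) ^+ 2 <= b * 2^-1 ^+ k.
    move=> /hb; apply: le_trans; rewrite cmodE2 raddfB /=.
    by rewrite lerDl sqr_ge0.
  have him k m : (k <= m)%N ->
      (complex.Im (u m t) - complex.Im (u k t)) ^+ 2 <= b * 2^-1 ^+ k.
    move=> /hb; apply: le_trans; rewrite cmodE2 !raddfB /=.
    by rewrite lerDr sqr_ge0.
  have cre := limn_esup_fine_cvg (cvg_of_geometric_sq hre).
  have cim := limn_esup_fine_cvg (cvg_of_geometric_sq him).
  suff gb : cmod (g t - u n t) ^+ 2 <= b * 2^-1 ^+ n.
    apply: (le_trans (ler_wpM2r W0 gb)).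
    by rewrite /b le_eqVlt; apply/orP; left; apply/eqP; field.
  rewrite cmodE2 !raddfB /=.
  set x := complex.Re (u n t); set y := complex.Im (u n t).
  have sq (a : nat -> R) (l z : R) : a @ \oo --> l ->
      (fun m => (a m - z) ^+ 2) @ \oo --> (l - z) ^+ 2.
    by move=> al; apply: cvgM; apply: cvgB => //; exact: cvg_cst.
  apply: (cvgr_to_le (cvgD (sq _ _ x cre) (sq _ _ y cim))).
  exists n => // m /= nm; have := hb _ _ nm.
  by rewrite cmodE2 !raddfB.
have intc n : (\int[mu]_(t in D) ((2 * 2^-1 ^+ n)%:E * S t) =
    (2 * 2^-1 ^+ n)%:E * \int[mu]_(t in D) S t)%E.
  by apply: ge0_integralZl_EFin => //; rewrite mulr_ge0// exprn_ge0.
have le_int n : (\int[mu]_(t in D) (cmod (g t - u n t) ^+ 2 * W t)%:E <=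
    (2 * 2^-1 ^+ n)%:E * \int[mu]_(t in D) S t)%E.
  rewrite -intc; apply: ge0_le_integral => //.
  - by move=> t Dt; rewrite lee_fin mulr_ge0 ?sqr_ge0// (admissible_ge0 aW Dt).
  - apply/measurable_EFinP.
    by apply: measurable_integrand; [case: aW|exact: mB].
  - by apply: measurable_funeM.
  - by move=> t Dt; exact: key.
have fS : (\int[mu]_(t in D) S t)%E \is a fin_num.
  by rewrite ge0_fin_numE//; apply: integral_ge0.
have sg n : sqint W (fun t => g t - u n t).
  apply/(sqintP aW (mB _ _ mg)); apply: (le_lt_trans (le_int n)).
  by rewrite -(fineK fS) -EFinM ltry.
exists g, (2 * fine (\int[mu]_(t in D) S t)); split.
- apply: (@sqint_dom _ _ _ _ _ _ _ 2 aW mg (sg 0%N) (su 0%N)) => t Dt.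
  rewrite -mulrDl mulrA ler_wpM2r ?(admissible_ge0 aW Dt)//.
  by rewrite -{1}(subrK (u 0%N t) (g t)) cmod_sqD.
- by rewrite mulr_ge0// fine_ge0// integral_ge0.
move=> n; rewrite -lee_fin wnorm2_EFin//; apply: (le_trans (le_int n)).
rewrite -{1}(fineK fS) -EFinM lee_fin.
by rewrite le_eqVlt; apply/orP; left; apply/eqP; ring.
Qed.

End Completeness.

(** * Almost best approximation in place of the orthogonal projection *)

Section HilbertGeometry.
Variable R : realType.
Implicit Types (f g h : R -> R[i]) (s p q : seq (int * R[i])) (a : R[i]) (e : R).
Let mu := @lebesgue_measure R.
Let D := @circle_dom R.
Hint Resolve circle_dom_measurable : core.
Variable W : R -> R.
Hypothesis aW : admissible W.

Let W0 t : D t -> 0 <= W t. Proof. exact: admissible_ge0. Qed.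

Lemma sqintZ a f : sqint W f -> sqint W (fun t => a * f t).
Proof.
move=> sf; apply: (@sqint_dom _ _ _ _ _ _ _ (cmod a ^+ 2) aW _ sf sf).
  exact: cmeasurableM (cmeasurable_cst a) sf.1.
move=> t Dt; rewrite cmodM exprMn -mulrA ler_wpM2l ?sqr_ge0// lerDl.
by rewrite mulr_ge0 ?sqr_ge0// W0.
Qed.

Lemma sqintD f g : sqint W f -> sqint W g -> sqint W (fun t => f t + g t).
Proof.
move=> sf sg; apply: (@sqint_dom _ _ _ _ _ _ _ 2 aW _ sf sg).
  exact: cmeasurableD sf.1 sg.1.
by move=> t Dt; rewrite -mulrDl mulrA ler_wpM2r ?W0// cmod_sqD.
Qed.

Lemma sqintB f g : sqint W f -> sqint W g -> sqint W (fun t => f t - g t).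
Proof.
move=> sf sg; have := sqintD sf (sqintZ (-1) sg).
by under eq_fun do rewrite mulN1r.
Qed.

Lemma wnorm2Z a f : sqint W f -> wnorm2 W (fun t => a * f t) = cmod a ^+ 2 * wnorm2 W f.
Proof.
move=> [_ fi]; rewrite /wnorm2 -RintegralZl//; apply: eq_Rintegral => t _.
by rewrite cmodM exprMn mulrA.
Qed.

Lemma wnorm2_parallelogram f g : sqint W f -> sqint W g ->
  wnorm2 W (fun t => f t + g t) + wnorm2 W (fun t => f t - g t) =
  2 * (wnorm2 W f + wnorm2 W g).
Proof.
move=> sf sg; have [_ i1] := sqintD sf sg; have [_ i2] := sqintB sf sg.
case: (sf) => _ i3; case: (sg) => _ i4.
have i5 := integrableD (@circle_dom_measurable R) i3 i4.
rewrite /wnorm2 -RintegralD// -RintegralD// -RintegralZl//.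
by apply: eq_Rintegral => t _; rewrite -mulrDl cmod_parallelogram mulrDr; ring.
Qed.

Lemma wnorm2_nonneg f : 0 <= wnorm2 W f.
Proof. exact: wnorm2_ge0. Qed.

Lemma wnorm2_sqD f g : sqint W f -> sqint W g ->
  wnorm2 W (fun t => f t + g t) <= 2 * (wnorm2 W f + wnorm2 W g).
Proof.
move=> sf sg; rewrite -wnorm2_parallelogram// lerDl; exact: wnorm2_nonneg.
Qed.

Lemma wnorm2_distC f g : wnorm2 W (fun t => f t - g t) = wnorm2 W (fun t => g t - f t).
Proof. by apply: eq_wnorm2 => t; rewrite cmod_distC. Qed.

Lemma wnorm2_triangle f g h : sqint W f -> sqint W g -> sqint W h ->
  wnorm2 W (fun t => f t - h t) <=
  2 * (wnorm2 W (fun t => f t - g t) + wnorm2 W (fun t => g t - h t)).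
Proof.
move=> sf sg sh; have := wnorm2_sqD (sqintB sf sg) (sqintB sg sh).
by under eq_fun do rewrite subrKA.
Qed.

Let st s : sqint W (trigpoly s). Proof. exact: sqint_trigpoly. Qed.
Let sft f s : sqint W f -> sqint W (fun t => f t - trigpoly s t).
Proof. by move=> sf; exact: sqintB. Qed.

Definition trig_dist2 f : R :=
  inf (range (fun s => wnorm2 W (fun t => f t - trigpoly s t))).

(** Approximate minimizers stand in for the projection of f, so the closure of the polynomials is
    never formed. *)
Definition near_best f e s :=
  wnorm2 W (fun t => f t - trigpoly s t) <= trig_dist2 f + e.

Lemma trig_dist2_le f s : trig_dist2 f <= wnorm2 W (fun t => f t - trigpoly s t).
Proof.
apply: ge_inf; last by exists s.
by exists 0 => _ [s' _ <-]; exact: wnorm2_nonneg.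
Qed.

Lemma trig_dist2_ge (r : R) f : (forall s, r <= wnorm2 W (fun t => f t - trigpoly s t)) ->
  r <= trig_dist2 f.
Proof.
move=> h; apply: lb_le_inf; last by move=> _ [s' _ <-].
by exists (wnorm2 W (fun t => f t - trigpoly [::] t)), [::].
Qed.

Lemma near_best_exists f e : 0 < e -> exists s, near_best f e s.
Proof.
move=> e0; have [|_ [s _ <-] hs] := @inf_adherent R
  (range (fun s => wnorm2 W (fun t => f t - trigpoly s t))) e e0.
  split; first by exists (wnorm2 W (fun t => f t - trigpoly [::] t)), [::].
  by exists 0 => _ [s' _ <-]; exact: wnorm2_nonneg.
by exists s; exact: ltW.
Qed.

Lemma near_best_weaken f e e' s : e <= e' -> near_best f e s -> near_best f e' s.
Proof. by move=> ee' h; apply: le_trans h _; rewrite lerD2l. Qed.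

(* [p] and [q] are compared through their mean, by the parallelogram law. *)
Lemma near_best_close f e p q : sqint W f -> near_best f e p -> near_best f e q ->
  wnorm2 W (fun t => trigpoly p t - trigpoly q t) <= 4 * e.
Proof.
move=> sf hp hq; have := wnorm2_parallelogram (sft p sf) (sft q sf).
rewrite (@eq_wnorm2 _ _ (fun t => f t - trigpoly p t - (f t - trigpoly q t))
  (fun t => trigpoly p t - trigpoly q t)); last first.
  by move=> t; rewrite cmod_distC; congr cmod; ring.
have := trig_dist2_le f (fmul (fun=> 2^-1) (p ++ q)).
have e2 : (fun t => f t - trigpoly p t + (f t - trigpoly q t)) =
    (fun t => 2 * (f t - trigpoly (fmul (fun=> 2^-1) (p ++ q)) t)).
  by apply/funext => t; rewrite trigpoly_scale trigpoly_cat; field.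
rewrite e2 wnorm2Z; last exact: sft.
have -> : cmod (2 : R[i]) = 2.
  by rewrite (_ : 2 = 2%:C) ?cmod_real ?ger0_norm// rmorph_nat.
by move: hp hq; rewrite /near_best; lra.
Qed.

(** Additivity of the projection, without an inner product. Let d be the squared distance to the
    polynomials. The parallelogram law for almost best approximations of f + g and f - g gives 2
    (d(f) + d(g)) <= d(f + g) + d(f - g). Applied to p and q it gives the reverse comparison up to 4
    e. *)
Lemma near_bestD f g e p q : sqint W f -> sqint W g ->
  near_best f e p -> near_best g e q ->
  near_best (fun t => f t + g t) (4 * e) (p ++ q).
Proof.
move=> sf sg hp hq; apply/ler_addgt0Pr => d d0.
have d2 : 0 < d / 2 by rewrite divr_gt0.
have [r hr] := near_best_exists (fun t => f t + g t) d2.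
have [r' hr'] := near_best_exists (fun t => f t - g t) d2.
have P1 := wnorm2_parallelogram (sft p sf) (sft q sg).
pose pq := p ++ fmul (fun=> -1) q.
(* Half the sum and half the difference of [r] and [r'], so that s1 + s2 and s1 - s2 represent [r]
   and [r']. *)
pose s1 := fmul (fun=> 2^-1) (r ++ r').
pose s2 := fmul (fun=> 2^-1) (r ++ fmul (fun=> -1) r').
have E1 : (fun t => f t - trigpoly p t + (g t - trigpoly q t)) =
    (fun t => f t + g t - trigpoly (p ++ q) t).
  by apply/funext => t; rewrite trigpoly_cat; ring.
have E2 : (fun t => f t - trigpoly p t - (g t - trigpoly q t)) =
    (fun t => f t - g t - trigpoly pq t).
  by apply/funext => t; rewrite trigpoly_cat trigpoly_scale; ring.
rewrite E1 E2 in P1.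
have P2 := trig_dist2_le (fun t => f t - g t) pq.
have P3 := wnorm2_parallelogram (sft s1 sf) (sft s2 sg).
have E3 : (fun t => f t - trigpoly s1 t + (g t - trigpoly s2 t)) =
    (fun t => f t + g t - trigpoly r t).
  apply/funext => t; rewrite !(trigpoly_scale, trigpoly_cat).
  by field.
have E4 : (fun t => f t - trigpoly s1 t - (g t - trigpoly s2 t)) =
    (fun t => f t - g t - trigpoly r' t).
  apply/funext => t; rewrite !(trigpoly_scale, trigpoly_cat).
  by field.
rewrite E3 E4 in P3.
have P4 := trig_dist2_le f s1; have P5 := trig_dist2_le g s2.
move: hp hq hr hr'; rewrite /near_best.
move: P1 P2 P3 P4 P5 => *; lra.
Qed.

Lemma near_bestZ a f e p : sqint W f -> near_best f e p ->
  near_best (fun t => a * f t) (cmod a ^+ 2 * e) (fmul (fun=> a) p).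
Proof.
move=> sf hp; rewrite /near_best.
have -> : (fun t => a * f t - trigpoly (fmul (fun=> a) p) t) =
    (fun t => a * (f t - trigpoly p t)).
  by apply/funext => t; rewrite trigpoly_scale mulrBr.
rewrite wnorm2Z; last exact: sft.
apply: (le_trans (ler_wpM2l (sqr_ge0 (cmod a)) hp)); rewrite mulrDr lerD2r.
apply: trig_dist2_ge => s; have [->|a0] := eqVneq a 0.
  by rewrite cmod0 expr0n mul0r wnorm2_nonneg.
have -> : (fun t => a * f t - trigpoly s t) =
    (fun t => a * (f t - trigpoly (fmul (fun=> a^-1) s) t)).
  by apply/funext => t; rewrite trigpoly_scale; field.
rewrite wnorm2Z; last exact: sft.
by rewrite ler_wpM2l ?sqr_ge0// trig_dist2_le.
Qed.

Variables (m : int -> R[i]) (K : R).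
Hypothesis K0 : 0 <= K.
Hypothesis hK : forall s, wnorm2 W (trigpoly (fmul m s)) <= K * wnorm2 W (trigpoly s).

Let hKB p q : wnorm2 W (fun t => trigpoly (fmul m p) t - trigpoly (fmul m q) t) <=
  K * wnorm2 W (fun t => trigpoly p t - trigpoly q t).
Proof.
have e p' q' : (fun t => trigpoly p' t - trigpoly q' t) =
    trigpoly (p' ++ fmul (fun=> -1) q').
  by apply/funext => t; rewrite trigpoly_cat trigpoly_scale mulN1r.
by rewrite !e fmulC -fmul_cat.
Qed.

(* The value at [f] of the extension that vanishes on the orthogonal complement
   of the trigonometric polynomials. *)
Definition mult_extension f g := sqint W g /\ forall e, 0 < e ->
  exists2 s, near_best f e s & wnorm2 W (fun t => g t - trigpoly (fmul m s) t) <= e.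

(** Almost best approximations with errors 4^(-n) are mutually close at the same rate, and so are
    their images; this is the speed required by [sqint_complete]. *)
Lemma mult_extension_exists f : sqint W f -> exists g, mult_extension f g.
Proof.
move=> sf.
have q0 n : 0 < 4^-1 ^+ n :> R by rewrite exprn_gt0.
have /choice[s hs] : forall n, exists s, near_best f (4^-1 ^+ n) s.
  by move=> n; exact: near_best_exists.
have [|n|g [B [sg B0 hg]]] := @sqint_complete R W
    (fun n => trigpoly (fmul m (s n))) (K * 4) aW (fun n => st _).
- by rewrite mulr_ge0.
- apply: (le_trans (hKB _ _)); rewrite -mulrA ler_wpM2l//.
  apply: (near_best_close sf _ (hs n)); apply: near_best_weaken (hs n.+1).
  by rewrite exprS ler_piMl ?(ltW (q0 _))// invf_le1// ler1n.
exists g; split => // e e0.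
have : geometric (1 : R) 2^-1 @ \oo --> (0 : R).
  by apply: cvg_geometric; rewrite ger0_norm// invf_lt1// ltr1n.
move=> /cvgr0_norm_lt/(_ (e / (B + 1))) h.
have B1 : 0 < B + 1 by rewrite ltr_wpDl.
have [|n _ /(_ n (leqnn n))] := h; first by rewrite divr_gt0.
rewrite /= mul1r ger0_norm ?exprn_ge0// ltr_pdivlMr// => hn.
have p0 : 0 <= 2^-1 ^+ n :> R by rewrite exprn_ge0.
have Bp : 0 <= B * 2^-1 ^+ n by rewrite mulr_ge0.
exists (s n); last by apply: (le_trans (hg n)); lra.
apply: near_best_weaken (hs n); apply: (@le_trans _ _ (2^-1 ^+ n)); last by lra.
rewrite lerXn2r ?nnegrE ?invr_ge0//.
by rewrite lef_pV2 ?posrE// ler_nat.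
Qed.

(** Passes from some almost best [s] to every one, which makes the extension unique up to null
    functions. The constant is 2 (1 + 4 K), the 4 coming from [near_best_close]. *)
Lemma mult_extension_near f g e s : sqint W f -> mult_extension f g -> 0 < e ->
  near_best f e s ->
  wnorm2 W (fun t => g t - trigpoly (fmul m s) t) <= (2 + 8 * K) * e.
Proof.
move=> sf [sg h] e0 hs; have [s' hs' hg] := h _ e0.
apply: (le_trans (wnorm2_triangle sg (st (fmul m s')) (st (fmul m s)))).
have := hKB s' s; have := ler_wpM2l K0 (near_best_close sf hs' hs).
move: hg; lra.
Qed.

Lemma le0_of_small (x C : R) : 0 <= C -> (forall e, 0 < e -> x <= C * e) -> x <= 0.
Proof.
move=> C0 h; apply/ler_addgt0Pr => e e0; rewrite add0r.
have C1 : 0 < C + 1 by rewrite ltr_wpDl.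
apply: (le_trans (h (e / (C + 1)) _)); first by rewrite divr_gt0.
apply: (@le_trans _ _ ((C + 1) * (e / (C + 1)))).
  by rewrite ler_wpM2r ?lerDl// ltW// divr_gt0.
by rewrite mulrC divfK ?gt_eqF.
Qed.

Lemma mult_extension_linear a f g f' g' h : sqint W f -> sqint W f' ->
  mult_extension f g -> mult_extension f' g' ->
  mult_extension (fun t => a * f t + f' t) h ->
  wnorm2 W (fun t => h t - (a * g t + g' t)) = 0.
Proof.
move=> sf sf' eg eg' eh; apply/eqP; rewrite eq_le wnorm2_nonneg andbT.
(* A common accuracy factor for both summands: it exceeds the factor |a|^2 on the scaled one and the
   factor 1 on the other. *)
pose A := cmod a ^+ 2 + 1.
have A1 : 1 <= A by rewrite lerDr sqr_ge0.
have A0 : 0 <= A by apply: le_trans A1.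
apply: (@le0_of_small _ (2 * ((2 + 8 * K) * (4 * A)) + 4 * A)).
  by have := mulr_ge0 K0 A0; lra.
move=> e e0; case: (eg) => sg hg; case: (eg') => sg' hg'; have sh := eh.1.
have [s hs gs] := hg _ e0; have [s' hs' gs'] := hg' _ e0.
pose r := fmul (fun=> a) s ++ s'.
have nr : near_best (fun t => a * f t + f' t) (4 * (A * e)) r.
  apply: near_bestD => //; first exact: sqintZ.
    apply: near_best_weaken (near_bestZ a sf hs); rewrite ler_wpM2r ?ltW//.
    by rewrite ltrDl.
  apply: near_best_weaken hs'; apply: ler_peMl => //; exact: ltW.
have saf : sqint W (fun t => a * f t + f' t) by apply: sqintD => //; exact: sqintZ.
have sag : sqint W (fun t => a * g t + g' t) by apply: sqintD => //; exact: sqintZ.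
have e4 : 0 < 4 * (A * e) by rewrite !mulr_gt0// (lt_le_trans _ A1).
have H1 := mult_extension_near saf eh e4 nr.
have H2 := wnorm2_triangle sh (st (fmul m r)) sag.
have H3 : wnorm2 W (fun t => trigpoly (fmul m r) t - (a * g t + g' t)) <=
    2 * (cmod a ^+ 2 * e + e).
  have -> : (fun t => trigpoly (fmul m r) t - (a * g t + g' t)) =
     (fun t => - a * (g t - trigpoly (fmul m s) t) +
               -1 * (g' t - trigpoly (fmul m s') t)).
    apply/funext => t; rewrite /r fmul_cat trigpoly_cat fmulC trigpoly_scale.
    by ring.
  apply: (le_trans (wnorm2_sqD (sqintZ _ (sft _ sg)) (sqintZ _ (sft _ sg')))).
  rewrite !wnorm2Z; [|exact: sft..].
  rewrite !cmodN cmod1 expr1n mul1r ler_wpM2l// lerD//.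
  by rewrite ler_wpM2l ?sqr_ge0.
apply: (le_trans H2); move: H1 H3; rewrite /A; lra.
Qed.

(** The empty polynomial shows that the distance is at most the norm of f. Then the squared norm of
    [s] is at most 4 times that of f up to O(e), and one more triangle inequality doubles this to
    8. *)
Lemma mult_extension_bound f g : sqint W f -> mult_extension f g ->
  wnorm2 W g <= 8 * K * wnorm2 W f.
Proof.
move=> sf [sg h]; rewrite -subr_le0; apply: (@le0_of_small _ (2 + 8 * K)).
  by rewrite addr_ge0 ?mulr_ge0.
move=> e e0; have [s hs gs] := h _ e0.
have z0 : sqint W (fun=> 0 : R[i]).
  have := st [::]; rewrite (_ : trigpoly [::] = fun=> 0)//.
  by apply/funext => t; exact: trigpoly_nil.
have H1 := wnorm2_triangle sg (st (fmul m s)) z0.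
have H2 := wnorm2_triangle (st s) sf z0.
have sub0 f' : (fun t => f' t - 0) = f' by apply/funext => t; rewrite subr0.
have dist_le := trig_dist2_le f [::].
have nil0 : (fun t => f t - trigpoly [::] t) = f.
  by apply/funext => t; rewrite trigpoly_nil subr0.
rewrite nil0 in dist_le; rewrite !sub0 in H1 H2.
rewrite (wnorm2_distC (trigpoly s)) in H2.
have H3 : wnorm2 W (trigpoly s) <= 4 * wnorm2 W f + 2 * e.
  by move: H2 hs dist_le; rewrite /near_best; lra.
by have := ler_wpM2l K0 H3; have := hK s; move: gs H1; have := mulr_ge0 K0 (ltW e0); lra.
Qed.

End HilbertGeometry.

(** * Bounded operators versus bounds on trigonometric polynomials *)

Section MultipliersAsOperators.
Variable R : realType.
Implicit Types (f g h : R -> R[i]) (s : seq (int * R[i])) (a : R[i]) (m : int -> R[i]).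
Let mu := @lebesgue_measure R.
Let D := @circle_dom R.
Hint Resolve circle_dom_measurable : core.
Variable w : R[i] -> R.
Let W t := w (expi t).
Hypothesis aW : admissible W.

Let inv2pi_gt0 : 0 < (2 * pi)^-1 :> R.
Proof. by rewrite invr_gt0 mulr_gt0// pi_gt0. Qed.

Let ae_sub (P Q : R -> Prop) : (forall t, P t -> Q t) ->
  {ae @lebesgue_measure R, forall t, P t} -> {ae @lebesgue_measure R, forall t, Q t}.
Proof. by move=> h p; exact: (@filterS _ _ (ae_filter_ringOfSetsType mu) _ _ h p). Qed.

Let ae_sub2 (P Q S : R -> Prop) : (forall t, P t -> Q t -> S t) ->
  {ae @lebesgue_measure R, forall t, P t} -> {ae @lebesgue_measure R, forall t, Q t} ->
  {ae @lebesgue_measure R, forall t, S t}.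
Proof. by move=> h p q; exact: (@filterS2 _ _ (ae_filter_ringOfSetsType mu) _ _ _ h p q). Qed.

Lemma inL2P f : inL2 w f <-> sqint W f.
Proof.
have I0 : (0 <= \int[mu]_(t in D) (cmod (f t) ^+ 2 * W t)%:E)%E.
  apply: integral_ge0 => t Dt.
  by rewrite lee_fin mulr_ge0 ?sqr_ge0// (admissible_ge0 aW Dt).
split=> [[mf]|sf]; last first.
  split; first exact: sf.1.
  by rewrite /normL2 poweR_lty// -[X in (_ * X)%E](wnorm2_EFin sf) -EFinM ltry.
rewrite /normL2 => h; apply/(sqintP aW mf); rewrite ltey; apply: contraTN h => /eqP.
by rewrite /W => ->; rewrite gt0_muley ?lte_fin// poweRyr ?ltxx.
Qed.

Lemma normL2E f : sqint W f -> normL2 w f = (((2 * pi)^-1 * wnorm2 W f) `^ 2^-1)%:E.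
Proof. by move=> sf; rewrite /normL2 -[X in (_ * X)%E](wnorm2_EFin sf) -EFinM poweR_EFin. Qed.

Lemma powR_half_sqr (x : R) : 0 <= x -> (x `^ 2^-1) ^+ 2 = x.
Proof. by move=> x0; rewrite -powR_mulrn ?powR_ge0// -powRrM mulVf// powRr1. Qed.

Lemma normL2_le_sqr f g (C : R) : sqint W f -> sqint W g ->
  (normL2 w f <= C%:E * normL2 w g)%E -> wnorm2 W f <= C ^+ 2 * wnorm2 W g.
Proof.
move=> sf sg; rewrite !normL2E// -EFinM lee_fin => h.
have pos u : 0 <= (2 * pi)^-1 * wnorm2 W u :> R.
  by rewrite mulr_ge0 ?(ltW inv2pi_gt0)//; exact: wnorm2_nonneg.
rewrite -(ler_pM2l inv2pi_gt0) mulrCA -(powR_half_sqr (pos f)) -[leRHS]/(_ * _).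
rewrite -(powR_half_sqr (pos g)) -exprMn lerXn2r ?nnegrE ?powR_ge0//.
by apply: le_trans h; exact: powR_ge0.
Qed.

Lemma normL2_le_of_sqr f g (K : R) : 0 <= K -> sqint W f -> sqint W g ->
  wnorm2 W f <= K * wnorm2 W g -> (normL2 w f <= (K `^ 2^-1)%:E * normL2 w g)%E.
Proof.
move=> K0 sf sg h; rewrite !normL2E// -EFinM lee_fin.
have pos u : 0 <= (2 * pi)^-1 * wnorm2 W u :> R.
  by rewrite mulr_ge0 ?(ltW inv2pi_gt0)//; exact: wnorm2_nonneg.
rewrite -powRM//; apply: ge0_ler_powR; rewrite ?nnegrE.
- by rewrite invr_ge0.
- exact: pos.
- exact: mulr_ge0 K0 (pos g).
- by rewrite mulrCA ler_pM2l.
Qed.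

Lemma eqL2_wnorm2 f g : sqint W f -> sqint W g -> eqL2 w f g -> wnorm2 W f = wnorm2 W g.
Proof.
move=> sf sg fg; apply: EFin_inj; rewrite !wnorm2_EFin//.
have mi u : sqint W u -> measurable_fun D (fun t => (cmod (u t) ^+ 2 * W t)%:E).
  move=> [mu_ _]; apply/measurable_EFinP.
  by apply: measurable_integrand; [case: aW|exact: mu_].
apply: ge0_ae_eq_integral => //; try exact: mi.
- by move=> t Dt; rewrite lee_fin mulr_ge0 ?sqr_ge0// (admissible_ge0 aW Dt).
- by move=> t Dt; rewrite lee_fin mulr_ge0 ?sqr_ge0// (admissible_ge0 aW Dt).
apply: ae_sub fg => t ft Dt; have [W0|Wn0] := eqVneq (W t) 0.
  by rewrite W0 !mulr0.
by rewrite ft.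
Qed.

Lemma wnorm2_eq0_eqL2 f g : sqint W f -> sqint W g ->
  wnorm2 W (fun t => f t - g t) = 0 -> eqL2 w f g.
Proof.
move=> sf sg h.
have sfg : sqint W (fun t => f t - g t) by exact: sqintB.
have mi : measurable_fun D (fun t => (cmod (f t - g t) ^+ 2 * W t)%:E).
  apply/measurable_EFinP.
  by apply: measurable_integrand; [case: aW|exact: sfg.1].
have : (\int[mu]_(t in D) `|(cmod (f t - g t) ^+ 2 * W t)%:E| = 0)%E.
  transitivity (\int[mu]_(t in D) (cmod (f t - g t) ^+ 2 * W t)%:E)%E.
    apply: eq_integral => t; rewrite inE => Dt /=.
    by rewrite ger0_norm// mulr_ge0 ?sqr_ge0// (admissible_ge0 aW Dt).
  by rewrite -(wnorm2_EFin sfg) h.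
move=> /(ae_eq_integral_abs mu (@circle_dom_measurable R) mi).
apply: ae_sub => t ht Dt Wn0; have [] := ht Dt => /eqP.
rewrite mulf_eq0 (negbTE Wn0) orbF sqrf_eq0 cmod_eq0 subr_eq0.
by move=> /eqP.
Qed.

Lemma eqL2_trans f g h : eqL2 w f g -> eqL2 w g h -> eqL2 w f h.
Proof.
by apply: ae_sub2 => t fg gh Dt Wt; rewrite fg// gh.
Qed.

Lemma Mult_bounded_mult m : Mult w m -> bounded_mult W W m.
Proof.
move=> [T [Tst Tlin [C TC]] Tm].
have st s : inL2 w (trigpoly s) by apply/inL2P; exact: sqint_trigpoly.
(* Linearity with scalar -1 at f = g = 0 reads T 0 = - T 0 + T 0. *)
have T0 : eqL2 w (T (trigpoly [::])) (trigpoly [::]).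
  have := Tlin (-1) _ _ (st [::]) (st [::]).
  have -> : (fun t : R => -1 * trigpoly [::] t + trigpoly [::] t) = trigpoly [::].
    by apply/funext => t; rewrite trigpoly_nil mulr0 addr0.
  by apply: ae_sub => t h Dt Wt; rewrite h// trigpoly_nil mulN1r addNr.
have Ts s : eqL2 w (T (trigpoly s)) (trigpoly (fmul m s)).
  elim: s => [|p s IH]; first exact: T0.
  have sc : inL2 w (char_circle p.1) by apply/inL2P; exact: sqint_char.
  have := Tlin p.2 _ _ sc (st s).
  have -> : (fun t => p.2 * char_circle p.1 t + trigpoly s t) = trigpoly (p :: s).
    by apply/funext => t; rewrite /trigpoly big_cons.
  move=> h; apply: (eqL2_trans h).
  have := Tm p.1; apply: ae_sub2 IH => t h1 h2 Dt Wt.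
  by rewrite h1// h2// /trigpoly big_cons /= mulrCA mulrA.
exists (C ^+ 2); first exact: sqr_ge0.
move=> s; have sT : sqint W (T (trigpoly s)) by apply/inL2P/Tst.
rewrite -(eqL2_wnorm2 sT (sqint_trigpoly _ aW) (Ts s)).
by apply: normL2_le_sqr => //; [exact: sqint_trigpoly|exact: TC].
Qed.

Lemma bounded_mult_Mult m : bounded_mult W W m -> Mult w m.
Proof.
move=> [K K0 hK].
(* Outside L^2(w) the value of T is unconstrained, and f itself serves. *)
have /choice[T hT] : forall f, exists g, sqint W f -> mult_extension W m f g.
  move=> f; have [sf|nsf] := pselect (sqint W f); last by exists f.
  by have [g hg] := mult_extension_exists aW K0 hK sf; exists g.
have sT f : sqint W f -> sqint W (T f) by move=> /hT[].
exists T; first split.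
- by move=> f /inL2P sf; apply/inL2P; exact: sT.
- move=> a f g /inL2P sf /inL2P sg.
  have saf : sqint W (fun t => a * f t + g t) by apply: sqintD => //; exact: sqintZ.
  apply: wnorm2_eq0_eqL2; first exact: sT.
    exact: (sqintD aW (sqintZ aW a (sT _ sf)) (sT _ sg)).
  by apply: (mult_extension_linear aW K0 hK sf sg); exact: hT.
- exists ((8 * K) `^ 2^-1) => f /inL2P sf.
  apply: normL2_le_of_sqr => //; [by rewrite mulr_ge0|exact: sT|].
  by apply: (mult_extension_bound aW K0 hK sf); exact: hT.
move=> n; have sc := sqint_char n aW.
have e1 : (fun t => m n * char_circle n t) = trigpoly (fmul m [:: (n, 1)]).
  by apply/funext => t; rewrite /trigpoly big_seq1 /= mulr1.
rewrite e1; apply: wnorm2_eq0_eqL2; [exact: sT|exact: sqint_trigpoly|].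
apply/eqP; rewrite eq_le wnorm2_nonneg// andbT.
apply: (@le0_of_small R _ (2 + 8 * K)); first by rewrite addr_ge0 ?mulr_ge0.
(* A character is its own best approximation, at distance 0, hence almost best for every e. *)
move=> e e0; apply: (mult_extension_near aW K0 hK sc (hT _ sc) e0).
rewrite /near_best (_ : (fun t => _) = trigpoly [::]); last first.
  by apply/funext => t; rewrite trigpoly_seq1 trigpoly_nil subrr.
rewrite (_ : wnorm2 W _ = 0); last first.
  rewrite /wnorm2 (@eq_Rintegral _ _ _ _ _ (fun=> 0)) ?Rintegral_cst ?mul0r//.
  by move=> t _; rewrite trigpoly_nil cmod0 expr0n mul0r.
rewrite addr_ge0 ?(ltW e0)//; apply: trig_dist2_ge => s.
exact: wnorm2_nonneg.
Qed.

End MultipliersAsOperators.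

(** * The weight with two zeros and the boundedness of its multipliers *)

Section TwoZeroWeight.
Variable R : realType.

Lemma sin_int_pi (n : int) : sin (pi * n%:~R) = 0 :> R.
Proof.
have h (k : nat) : sin (pi * k%:R) = 0 :> R.
  elim: k => [|k IH]; first by rewrite mulr0 sin0.
  by rewrite -natr1 mulrDr mulr1 sinD sinpi IH mul0r mulr0 addr0.
case: n => k; first exact: h.
by rewrite NegzE mulrNz mulrN sinN h oppr0.
Qed.

Lemma sin_eq0_int_pi (x : R) : sin x = 0 -> exists n : int, x = pi * n%:~R.
Proof.
move=> sx; pose n := Num.floor (x / pi); exists n.
have pi0 := @pi_gt0 R.
have /andP[h1 h2] : pi * n%:~R <= x < pi * n%:~R + pi.
  have /andP[h1 h2] := floor_itv (x / pi).
  have ex : x = pi * (x / pi) by rewrite mulrC divfK// gt_eqF.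
  rewrite {1}ex ler_pM2l// h1 /= {1}ex -[X in _ < _ + X]mulr1 -mulrDr ltr_pM2l//.
  by rewrite intrD in h2.
have s0 : sin (x - pi * n%:~R) = 0.
  by rewrite sinB sx sin_int_pi mul0r mulr0 subrr.
apply/eqP; rewrite eq_sym eq_le h1 /= leNgt; apply/negP => h3.
have : 0 < sin (x - pi * n%:~R) by apply: sin_gt0_pi; apply/andP; split; lra.
by rewrite s0 ltxx.
Qed.

Lemma two_zero_weightE (alpha beta theta : R) :
  (fun t => two_zero_weight alpha beta theta (expi t)) =
  (fun t => pow_weight beta 0 t * pow_weight alpha theta t).
Proof. by apply/funext => t; rewrite /pow_weight expi0. Qed.

(* [|z - 1|^2 |z - zeta|^2 <= 16 w] bounds the norm of [1] from below, so the
   symbol is bounded by the operator norm. *)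
Lemma bounded_mult_symbol_bounded (alpha beta theta : R) m :
  0 < alpha <= 1 -> 0 < beta <= 1 ->
  let W t := pow_weight beta 0 t * pow_weight alpha theta t in
  bounded_mult W W m -> exists M, forall n, cmod (m n) <= M.
Proof.
move=> ha hb W [K K0 hK].
have aW : admissible W by apply: admissibleM; exact: admissible_pow_weight.
have a1 : admissible (fun=> 1 : R) by exact: admissible_cst.
pose zeta := expi theta.
(* The coefficients of (z - 1)(z - zeta). The leading coefficient 1 makes its norm positive by
   Parseval. *)
pose P : seq (int * R[i]) := [:: (2%:Z, 1); (1%:Z, - (1 + zeta)); (0%:Z, zeta)].
have cP t : trigpoly P t = (expi t - 1) * (expi t - zeta).
  rewrite /trigpoly !big_cons big_nil /= char_circle0 char_circle1.
  by rewrite (char_circleX 2); ring.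
have Ipos : 0 < wnorm2 W (trigpoly [:: (0, 1)]).
  have : 0 < wnorm2 (fun=> 1) (trigpoly P).
    rewrite (@parseval _ P [:: 2%:Z; 1%:Z; 0%:Z])//; last first.
      by move=> p; rewrite !inE => /or3P[] /eqP ->.
    rewrite mulr_gt0 ?mulr_gt0 ?pi_gt0// big_cons.
    rewrite ltr_pwDl ?sumr_ge0// => [|i _]; last exact: sqr_ge0.
    have -> : coef P 2%:Z = 1 by rewrite /coef /P !big_cons big_nil /= addr0.
    by rewrite cmod1 expr1n.
  move=> /lt_le_trans/(_ (_ : _ <= 16 * wnorm2 W (trigpoly [:: (0, 1)]))).
  rewrite pmulr_rgt0//; apply.
  apply: wnorm2_dom1; try exact: sqint_trigpoly.
  move=> t _; rewrite cP trigpoly_seq1 char_circle0 cmod1 expr1n mul1r mulr1.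
  have h1 : cmod (expi t - 1) ^+ 2 <= 4 * pow_weight beta 0 t.
    by rewrite -(expi0 R) sqr_le_powR// cmod_expiB_le2.
  have h2 : cmod (expi t - zeta) ^+ 2 <= 4 * pow_weight alpha theta t.
    by rewrite sqr_le_powR// cmod_expiB_le2.
  have -> : 16 * W t = (4 * pow_weight beta 0 t) * (4 * pow_weight alpha theta t).
    by rewrite /W; ring.
  by rewrite cmodM exprMn; exact: ler_pM (sqr_ge0 _) (sqr_ge0 _) h1 h2.
(* Testing on one character gives |m n|^2 <= K, and 1 + K bounds the square root of K. *)
exists (1 + K) => n; have := hK [:: (n, 1)].
have eI s' : (forall t, cmod (trigpoly s' t) = 1) ->
    wnorm2 W (trigpoly s') = wnorm2 W (trigpoly [:: (0, 1)]).
  move=> h; apply: eq_wnorm2 => t; rewrite h trigpoly_seq1.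
  by rewrite cmod_char_circle.
rewrite (eI [:: (n, 1)]); last first.
  by move=> t; rewrite trigpoly_seq1 cmod_char_circle.
rewrite (_ : wnorm2 W (trigpoly (fmul m [:: (n, 1)])) =
    cmod (m n) ^+ 2 * wnorm2 W (trigpoly [:: (0, 1)])); last first.
  rewrite -wnorm2Z; last exact: sqint_trigpoly.
  apply: eq_wnorm2 => t; rewrite trigpoly_seq1 /trigpoly big_seq1 /= mulr1.
  by rewrite !cmodM !cmod_char_circle.
rewrite ler_pM2r// => h; have := cmod_ge0 (m n); nra.
Qed.

End TwoZeroWeight.

Theorem theorem5p9 (R : realType) (alpha beta theta : R) (lambda : int -> R[i])
    (halpha : 0 < alpha) (halphabeta : alpha < beta) (hbeta : beta < 1)
    (htheta : forall n : int, theta <> pi * n%:~R)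
    (hlambda : Mult (two_zero_weight alpha beta theta) lambda)
    (hinf : 0 < inf (range (fun j : int => cmod (lambda j)))) :
  Mult (two_zero_weight alpha beta theta) (fun j : int => (lambda j)^-1).
Proof.
have ha : 0 < alpha < 1 by rewrite halpha (lt_trans halphabeta).
have hb : 0 < beta < 1 by rewrite hbeta (lt_trans halpha).
have sin_neq0 : sin theta != 0.
  by apply/eqP => /sin_eq0_int_pi[n /htheta].
have aW : admissible (fun t => two_zero_weight alpha beta theta (expi t)).
  by rewrite two_zero_weightE; exact: admissible_two_zeros.
have := Mult_bounded_mult aW hlambda; rewrite two_zero_weightE => Bl.
have [M hM] : exists M, forall n, cmod (lambda n) <= M.
  by apply: bounded_mult_symbol_bounded Bl; [case/andP: ha|case/andP: hb] => -> /ltW.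
apply: (bounded_mult_Mult aW); rewrite two_zero_weightE.
apply: (bounded_mult_inverse ha hb (ltW halphabeta) sin_neq0 hinf hM) Bl => n.
apply: ge_inf; last by exists n.
by exists 0 => _ [k _ <-]; exact: cmod_ge0.
Qed.
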